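(* Let $\mathcal{G}(\mathcal{A},J)$ be an $N$-player game satisfying assumptions A1 (smoothness) and A2 (player-wise convexity), with pseudogradient $F$ and game Hessian $H$, and let $a^*$ be a stable Nash equilibrium of $\mathcal{G}(\mathcal{A},J)$. Let $F(\cdot,\cdot):\mathbb{R}^n\times\mathcal{V}\to\mathbb{R}^n$ and $H(\cdot,\cdot):\mathbb{R}^n\times\mathcal{V}\to\mathbb{R}^{n\times n}$ be perturbed versions of $F$ and $H$, with $F(a,0)=F(a)$ and $H(a,0)=H(a)$, both uniformly Lipschitz continuous in their arguments at $(a^*,0)$. Then there exist $\delta_a>0$, $\delta_v>0$, $L_a<1$ and $L_v<\infty$ such that for every $a^0\in\mathcal{A}\cap\mathbf{B}(a^*,\delta_a)$ and every disturbance sequence $\mathbf{v}=\{v^k\}_{k=0}^\infty$ in $\mathcal{V}$ with $\|\mathbf{v}\|_\infty=\sup_k\|v^k\|<\delta_v$, the sequence $\{a^k\}$ generated from $a^0$ by the perturbed Josephy-Newton update, in which $a^{k+1}$ is a solution $a$ of $$F(a^k,v^k)+H(a^k,v^k)(a-a^k)+\mathcal{N}_{\mathcal{A}}(a)\ni 0,$$ satisfies $$\|a^{k+1}-a^*\|\le L_a\|a^k-a^*\|+L_v\|v^k\|.$$ That is, the perturbed Josephy-Newton update is locally input-to-state stable around $a^*$.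
   Context: Game. Each player $i\in\{1,\dots,N\}$ has cost $J_i:\mathbb{R}^n\to\mathbb{R}$ and chooses $a_i\in\mathcal{A}_i\subseteq\mathbb{R}^{n_i}$, $n=\sum_i n_i$, $\mathcal{A}=\prod_{i=1}^N\mathcal{A}_i$; write $a=(a_1,\dots,a_N)=(a_i,a_{-i})$. A point $a^*$ is a Nash equilibrium (NE) if for every $i$, $a_i^*\in\arg\min_{a_i\in\mathcal{A}_i}J_i(a_i,a^*_{-i})$. $\mathrm{NESet}(\mathcal{G})$ denotes the set of all NEs of $\mathcal{G}$. A1 (smoothness): for every $i$, $J_i$ is twice continuously differentiable and its second-order derivatives are Lipschitz continuous. A2 (player-wise convexity): for every $i$ and every $a_{-i}$, $J_i(\cdot,a_{-i})$ is convex, and $\mathcal{A}_i$ is compact and convex. The pseudogradient is $F(a)=(\nabla_{a_i}J_i(a))_{i=1}^N$, $F:\mathbb{R}^n\to\mathbb{R}^n$. The game Hessian $H(a)\in\mathbb{R}^{n\times n}$ is the block matrix with $(i,j)$ block $\nabla^2_{a_ia_j}J_i(a)$. The normal cone to $\mathcal{A}$ at $a\in\mathcal{A}$ is $\mathcal{N}_{\mathcal{A}}(a)=\{b\in\mathbb{R}^n: b^T(a'-a)\le 0\ \forall a'\in\mathcal{A}\}$ (empty for $a\notin\mathcal{A}$). $\mathbf{B}(a^*,\delta)$ is the open ball with center $a^*$ and radius $\delta$. $\mathcal{V}$ is the set of disturbances; the disturbance can model, for example, inexact evaluation of the pseudogradient. Game neighborhood: for $\mathcal{S}\subset\mathcal{A}$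 and $\epsilon>0$, a game $\tilde{\mathcal{G}}(\mathcal{A},\tilde J)$ (same strategy sets) belongs to $\mathbf{B}(\mathcal{G};\epsilon,\mathcal{S})$ if it satisfies A1 and A2 and its pseudogradient $\tilde F$ satisfies $\sup_{a\in\mathcal{S}}\|F(a)-\tilde F(a)\|<\epsilon$ (Euclidean norm). Stable NE: an NE $a^*$ of $\mathcal{G}(\mathcal{A},J)$ is stable if for every open neighborhood $\Omega$ of $a^*$ satisfying $\mathrm{NESet}(\mathcal{G})\cap\Omega=\{a^*\}$ there exist two positive scalars $c$ and $\epsilon$ such that for every $\tilde{\mathcal{G}}\in\mathbf{B}(\mathcal{G};\epsilon,\mathcal{A}\cap\mathrm{cl}\,\Omega)$, where $\mathrm{cl}\,\Omega$ is the closure of $\Omega$: (i) $\mathrm{NESet}(\tilde{\mathcal{G}})\cap\mathrm{cl}\,\Omega\neq\emptyset$; and (ii) every $\tilde a\in\mathrm{NESet}(\tilde{\mathcal{G}})\cap\mathrm{cl}\,\Omega$ satisfies $\|\tilde a-a^*\|\le c\,\|F(\tilde a)-\tilde F(\tilde a)\|$.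
   Formalization: The equilibrium a* is assumed isolated (a non-isolated one is vacuously stable and the claim fails), and each a^{k+1} is a solution taken in B(a*,δ_a), since other solutions can violate the bound; existence of such a sequence is proved. *)

(* Defs.v *)
From HB Require Import structures.
From mathcomp Require Import all_boot all_order all_algebra.
From mathcomp Require Import all_classical all_reals all_analysis.

Set Implicit Arguments.
Unset Strict Implicit.
Unset Printing Implicit Defensive.

Import Order.TTheory GRing.Theory Num.Theory.
Import numFieldNormedType.Exports.

Local Open Scope classical_set_scope.
Local Open Scope ring_scope.

(* A joint action is a column vector of length
   n = \sum_i d i; the action of player i is its i-th block [submxcol a i]. *)

(* The library norm `|_| on matrices is the max norm; this is the Euclidean
   one. *)
Definition enorm {R : realType} {n : nat} (x : 'cV[R]_n) : R :=
  Num.sqrt (\sum_(j < n) x j ord0 ^+ 2).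

Definition eball {R : realType} {n : nat} (c : 'cV[R]_n) (r : R) :
    set 'cV[R]_n :=
  [set x | enorm (x - c) < r].

Notation profile R d := 'cV[R]_(\sum_i d i)%N.

Definition pderiv {R : realType} {n : nat} (j : 'I_n) (f : 'cV[R]_n -> R) :
    'cV[R]_n -> R :=
  fun a => 'D_(delta_mx j ord0) f a.

(* (x, a_{-i}) *)
Definition deviate {R : realType} {N : nat} {d : 'I_N -> nat}
    (a : profile R d) (i : 'I_N) (x : 'cV[R]_(d i)) : profile R d :=
  \mxcol_j dfwith (fun k => submxcol a k) i x j.

Definition profiles {R : realType} {N : nat} {d : 'I_N -> nat}
    (A : forall i, set 'cV[R]_(d i)) : set (profile R d) :=
  [set a | forall i, A i (submxcol a i)].

Definition is_NE {R : realType} {N : nat} {d : 'I_N -> nat}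
    (A : forall i, set 'cV[R]_(d i)) (J : 'I_N -> profile R d -> R)
    (a : profile R d) : Prop :=
  forall i, A i (submxcol a i) /\
    forall x, A i x -> J i a <= J i (deviate a x).

Definition NESet {R : realType} {N : nat} {d : 'I_N -> nat}
    (A : forall i, set 'cV[R]_(d i)) (J : 'I_N -> profile R d -> R) :
    set (profile R d) :=
  [set a | is_NE A J a].

(* Each cost is twice differentiable, with continuous and globally Lipschitz
   second-order partial derivatives. *)
Definition smooth_game {R : realType} {N : nat} {d : 'I_N -> nat}
    (J : 'I_N -> profile R d -> R) : Prop :=
  forall i,
  [/\ forall a, differentiable (J i) a,
      forall j a, differentiable (pderiv j (J i)) a,
      forall j k, continuous (pderiv k (pderiv j (J i))) &
      forall j k, lipschitz (pderiv k (pderiv j (J i)))].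

Definition playerwise_convex {R : realType} {N : nat} {d : 'I_N -> nat}
    (A : forall i, set 'cV[R]_(d i)) (J : 'I_N -> profile R d -> R) : Prop :=
  forall i,
  [/\ forall a, convex_function setT
        (fun x : 'cV[R]_(d i) => J i (deviate a x)),
      compact (A i) & convex_set (A i)].

Definition pseudogradient {R : realType} {N : nat} {d : 'I_N -> nat}
    (J : 'I_N -> profile R d -> R) (a : profile R d) : profile R d :=
  \mxcol_i \col_(k < d i) pderiv (tagnat.Rank i k) (J i) a.

(* The differentiation with respect to the coordinates of player i, giving
   the rows of block (i, j), is performed first, so that this is the Jacobian
   matrix of the pseudogradient. *)
Definition game_hessian {R : realType} {N : nat} {d : 'I_N -> nat}
    (J : 'I_N -> profile R d -> R) (a : profile R d) :
    'M[R]_(\sum_i d i)%N :=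
  \mxblock_(i < N, j < N) \matrix_(k < d i, l < d j)
    pderiv (tagnat.Rank j l) (pderiv (tagnat.Rank i k) (J i)) a.

Definition normal_cone {R : realType} {n : nat} (A : set 'cV[R]_n)
    (a : 'cV[R]_n) : set 'cV[R]_n :=
  [set b | A a /\
    forall a', A a' -> (b^T *m (a' - a)) ord0 ord0 <= 0].

(* The games of the neighborhood have the same strategy sets, so that they are
   identified with their cost functions. *)
Definition game_nbhd {R : realType} {N : nat} {d : 'I_N -> nat}
    (A : forall i, set 'cV[R]_(d i)) (J : 'I_N -> profile R d -> R)
    (eps : R) (S : set (profile R d)) : set ('I_N -> profile R d -> R) :=
  [set J' | [/\ smooth_game J', playerwise_convex A J' &
    (ereal_sup
       [set (enorm (pseudogradient J a - pseudogradient J' a))%:E | a in S]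
     < eps%:E)%E]].

(* The second conjunct says that a is an isolated equilibrium. It makes
   explicit what the quantification over isolating neighborhoods in the third
   one presupposes: a non-isolated equilibrium (e.g. any point when all costs
   are constant) would otherwise be vacuously stable. *)
Definition stable_NE {R : realType} {N : nat} {d : 'I_N -> nat}
    (A : forall i, set 'cV[R]_(d i)) (J : 'I_N -> profile R d -> R)
    (a : profile R d) : Prop :=
  let isolating (Om : set (profile R d)) :=
    [/\ open Om, Om a & NESet A J `&` Om = [set a]] in
  [/\ is_NE A J a,
      exists Om, isolating Om &
      forall Om, isolating Om ->
        exists c eps : R, [/\ 0 < c, 0 < eps &
          forall J', game_nbhd A J eps (profiles A `&` closure Om) J' ->
            NESet A J' `&` closure Om !=set0 /\
            forall a', (NESet A J' `&` closure Om) a' ->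
              enorm (a' - a) <=
                c * enorm (pseudogradient J a' - pseudogradient J' a')]].

(* Joint Lipschitz continuity on a neighborhood of (a, 0) in R^n x V, where V
   is a subset of the normed space W of disturbances. Replacing the Euclidean
   norm by the max norm only changes the Lipschitz constant. *)
Definition lipschitz_near {R : realType} {n : nat} {W : normedModType R}
    {E : normedModType R} (V : set W) (a : 'cV[R]_n)
    (G : 'cV[R]_n -> W -> E) : Prop :=
  exists2 r : R, 0 < r &
    [lipschitz G z.1 z.2 |
      z in [set z : 'cV[R]_n * W |
              [/\ eball a r z.1, V z.2 & `|z.2| < r]]].

(* x solves  G(a, v) + M(a, v) (x - a) + N_A(x) \ni 0. *)
Definition JN_update {R : realType} {n : nat} {W : normedModType R}
    (A : set 'cV[R]_n) (G : 'cV[R]_n -> W -> 'cV[R]_n)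
    (M : 'cV[R]_n -> W -> 'M[R]_n) (a : 'cV[R]_n) (v : W)
    (x : 'cV[R]_n) : Prop :=
  exists2 b, normal_cone A x b & G a v + M a v *m (x - a) + b = 0.

(* The linearized inclusion need not have a unique solution, even when the game
   has a unique equilibrium; as usual for Newton methods for generalized
   equations, the update selects a solution in a neighborhood U of the target
   equilibrium. *)
Definition JN_sequence {R : realType} {n : nat} {W : normedModType R}
    (A : set 'cV[R]_n) (G : 'cV[R]_n -> W -> 'cV[R]_n)
    (M : 'cV[R]_n -> W -> 'M[R]_n) (U : set 'cV[R]_n)
    (a0 : 'cV[R]_n) (v : nat -> W) (a : nat -> 'cV[R]_n) : Prop :=
  a 0%N = a0 /\
  forall k, JN_update A G M (a k) (v k) (a k.+1) /\ U (a k.+1).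

(* Main.v *)
(* Stability is applied only to games perturbed by costs that are linear in each
   player's own action, i.e. to constant shifts of the pseudogradient: if u
   solves the variational inequality of F + e, then |u - a*| <= c |e|. For an
   update u of a, the choice e = F(a, v) + H(a, v) (u - a) - F(u) is of order
   |u - a|^2 + |v|, which gives the contraction estimate.

   The linearized operator need not be the pseudogradient of a player-wise
   convex game, so that stability does not directly yield a solution of the
   update. But a stable equilibrium is the only equilibrium of the game, since
   an isolating neighborhood may reach up to another one. The estimate above is
   therefore global, and it suffices to solve the variational inequality of an
   operator equal to the linearized one near a* and to F away from a*: its
   solutions are forced into the region where the two operators agree. That
   inequality is solvable by the Hartman-Stampacchia theorem, which is derived
   here from Scarf's combinatorial lemma. *)

Require Import Defs.
From mathcomp Require Import all_boot zify.

Set Implicit Arguments.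
Unset Strict Implicit.
Unset Printing Implicit Defensive.

(** * Scarf's lemma *)

Section Scarf.
Variables (X I : finType) (r : I -> X -> nat) (c : X -> I).
Hypothesis r_inj : forall i, injective (r i).

(** Scarf's domination: no element lies strictly above the minima of a nonempty [U] in all orders at
    once. *)
Definition dominated (U : {set X}) :=
  [forall y, [exists i, [forall u in U, r i y <= r i u]]].

Lemma dominatedP (U : {set X}) :
  reflect (forall y, exists i, forall u, u \in U -> r i y <= r i u)
          (dominated U).
Proof.
apply: (iffP forallP) => domU y.
  by have /existsP[i /forall_inP ri] := domU y; exists i.
by have [i ri] := domU y; apply/existsP; exists i; apply/forall_inP.
Qed.

Lemma dominated_sub (U V : {set X}) : V \subset U -> dominated U -> dominated V.
Proof.
move=> VU /dominatedP domU; apply/dominatedP => y; have [i ri] := domU y.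
by exists i => u uV; apply: ri; apply: subsetP uV.
Qed.

Definition least (V : {set X}) (v0 : X) (i : I) : X :=
  [arg min_(v < v0 | v \in V) r i v].

Section Door.
Variables (V : {set X}) (v0 : X).
Hypotheses (Vv0 : v0 \in V) (domV : dominated V).
Local Notation mn := (least V v0).

Lemma least_in i : mn i \in V.
Proof. by rewrite /least; case: arg_minnP. Qed.

Lemma least_le i v : v \in V -> r i (mn i) <= r i v.
Proof. by rewrite /least; case: arg_minnP => // u _ H /H. Qed.

(** Domination applied to an element of [V] itself makes it the minimum of [V] in some order. *)
Lemma least_onto v : v \in V -> exists i, mn i = v.
Proof.
move=> vV; have /dominatedP/(_ v)[i ri] := domV.
exists i; apply: (@r_inj i); apply/eqP.
by rewrite eqn_leq least_le //= ri // least_in.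
Qed.

Lemma least_image : mn @: setT = V.
Proof.
apply/setP => v; apply/imsetP/idP => [[i _ ->]|/least_onto[i <-]].
  exact: least_in.
by exists i.
Qed.

End Door.

Lemma least_inj (U : {set X}) u0 : u0 \in U -> dominated U -> #|U| = #|I| ->
  injective (least U u0).
Proof.
move=> Uu0 domU cardU i j.
have : #|least U u0 @: setT| == #|[set: I]|.
  by rewrite least_image // cardU cardsT.
by move/imset_injP => inj; apply: inj; rewrite inE.
Qed.

(* A dominated set with one element less than there are orders can be completed
   to a dominated set by at most one element for each of the two orders sharing
   their minimum, and both completions exist unless the corresponding set of
   candidates is empty. *)
Section Completions.
Variables (V : {set X}) (v0 : X).
Hypotheses (Vv0 : v0 \in V) (domV : dominated V) (cardV : #|V|.+1 = #|I|).
Local Notation mn := (least V v0).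

(** The map [mn] sends the orders onto [V], which has one element fewer. *)
Lemma shared_min : exists i j, i != j /\ mn i = mn j.
Proof.
have /dinjectivePn[i _ [j /andP[ji _] mij]] : ~~ dinjectiveb mn predT.
  apply/negP => /dinjectiveP inj.
  have : #|mn @: setT| = #|I|.
    by rewrite card_in_imset ?cardsT // => x y _ _; apply: inj.
  by rewrite least_image // -cardV => /n_Sn.
by exists i, j; rewrite eq_sym.
Qed.

Definition candidates k := [set y | [forall l, (l != k) ==> (r l (mn l) < r l y)]].

Lemma candidatesP k y :
  reflect (forall l, l != k -> r l (mn l) < r l y) (y \in candidates k).
Proof. by rewrite inE; apply: (iffP forall_inP). Qed.

Section Shared.
Variables i j : I.
Hypotheses (ij : i != j) (mij : mn i = mn j).

Lemma shared_onto v : v \in V -> exists2 l, l != i & mn l = v.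
Proof.
move=> /(least_onto Vv0 domV)[l <-].
by have [->|li] := eqVneq l i; [exists j; rewrite // eq_sym|exists l].
Qed.

(** The order that dominates [y] must be [i], since [y] exceeds the minimum of [V] in every other
    order. *)
Lemma candidate_least y v : y \in candidates i -> v \in V -> r i y <= r i v.
Proof.
move=> /candidatesP yi; have /dominatedP/(_ y)[l rl] := domV.
have [<-|li] := eqVneq l i; first exact: rl.
by have := yi _ li; rewrite ltnNge rl // least_in.
Qed.

Lemma candidate_notin y : y \in candidates i -> y \notin V.
Proof.
move=> /candidatesP yi; apply/negP => /shared_onto[l li mly].
by have := yi l li; rewrite mly ltnn.
Qed.

(** Either [z] is a candidate, hence at most [y] and all of [V] in order [i], or it is at most some
    other minimum [mn l], which [y] exceeds. *)
Lemma candidate_completes y : y \in candidates i ->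
  (forall z, z \in candidates i -> r i z <= r i y) -> dominated (y |: V).
Proof.
move=> yi ymax; apply/dominatedP => z.
have [/[dup] zi /candidatesP zl|] := boolP (z \in candidates i).
  exists i => u /setU1P[->|uV]; first exact: ymax.
  exact: candidate_least.
rewrite inE negb_forall => /existsP[l]; rewrite negb_imply -leqNgt => /andP[li rl].
exists l => u /setU1P[->|uV].
  by apply: leq_trans rl _; apply: ltnW; have /candidatesP/(_ l li) := yi.
by apply: leq_trans rl _; exact: least_le.
Qed.

End Shared.

(** The minima of [y |: V] are pairwise distinct, so [y] is the minimum in a single order [k] and
    the other minima are those of [V]. As [i] and [j] share theirs in [V], one of them is [k]. *)
Lemma completion_candidate i j y : i != j -> mn i = mn j ->
  y \notin V -> dominated (y |: V) ->
  exists2 k, k \in [set i; j] &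
    y \in candidates k /\ forall z, z \in candidates k -> r k z <= r k y.
Proof.
move=> ij mij yV domU.
have yU : y \in y |: V by rewrite setU11.
have cardU : #|y |: V| = #|I| by rewrite cardsU1 yV.
have inj := least_inj yU domU cardU.
have [k mk] := least_onto yU domU yU.
have ml l : l != k -> least (y |: V) y l = mn l.
  move=> lk; have := least_in yU l.
  have /negbTE ne : least (y |: V) y l != y.
    by apply: contra lk => /eqP e; apply/eqP/inj; rewrite e mk.
  rewrite in_setU1 ne /= => lV.
  apply: (@r_inj l); apply/eqP; rewrite eqn_leq.
  by rewrite !least_le // setU1r // least_in.
have yk : y \in candidates k.
  apply/candidatesP => l lk; rewrite -ml // ltn_neqAle least_le // andbT.
  by apply: contra lk => /eqP/r_inj e; apply/eqP/inj; rewrite e mk.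
exists k.
  apply: contraT; rewrite !inE negb_or => /andP[ki kj].
  move: mij; rewrite -ml 1?eq_sym // -ml 1?eq_sym // => /inj eij.
  by rewrite eij eqxx in ij.
split=> // z /candidatesP zk.
have /dominatedP/(_ z)[l rl] := domU.
have [<-|lk] := eqVneq l k; first exact: rl.
by have := zk l lk; rewrite ltnNge rl // setU1r // least_in.
Qed.

Definition completions := [set y | (y \notin V) && dominated (y |: V)].

Lemma card_completions i j : i != j -> mn i = mn j ->
  #|completions| = (candidates i != set0) + (candidates j != set0).
Proof.
move=> ij mij.
have ji : j != i by rewrite eq_sym.
have mji := esym mij.
pose top k y := y \in candidates k /\ forall z, z \in candidates k -> r k z <= r k y.
have topE k : candidates k != set0 -> exists y, top k y.
  case/set0Pn => y0 y0k; exists [arg max_(y > y0 | y \in candidates k) r k y].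
  by case: arg_maxnP => // y yk ymax; split.
have top_uniq k y z : top k y -> top k z -> y = z.
  move=> [yk ym] [zk zm]; apply: (@r_inj k); apply/eqP.
  by rewrite eqn_leq ym // zm.
have top_compl k y : k \in [set i; j] -> top k y -> y \in completions.
  move=> + [yk ym]; rewrite !inE => /orP[]/eqP e; subst k.
    by rewrite (candidate_notin ij mij yk) (candidate_completes yk ym).
  by rewrite (candidate_notin ji mji yk) (candidate_completes yk ym).
have compl_top y : y \in completions -> exists2 k, k \in [set i; j] & top k y.
  by rewrite inE => /andP[yV dU]; exact: (completion_candidate ij mij yV dU).
have top0 k y : candidates k = set0 -> ~ top k y by move=> e [+ _]; rewrite e inE.
have [ei|/topE[yi ti]] := eqVneq (candidates i) set0;
    have [ej|/topE[yj tj]] := eqVneq (candidates j) set0.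
- apply/eqP; rewrite /= cards_eq0; apply/eqP/setP => y; rewrite [RHS]inE.
  by apply/negP => /compl_top[k /set2P[]-> ]; apply: top0.
- apply/eqP/cards1P; exists yj; apply/setP => y; rewrite [RHS]inE.
  apply/idP/eqP => [/compl_top[k /set2P[]-> t]|->].
  + by case: (top0 _ _ ei t).
  + exact: (top_uniq j).
  + by apply: top_compl tj; rewrite !inE eqxx orbT.
- apply/eqP/cards1P; exists yi; apply/setP => y; rewrite [RHS]inE.
  apply/idP/eqP => [/compl_top[k /set2P[]-> t]|->].
  + exact: (top_uniq i).
  + by case: (top0 _ _ ej t).
  + by apply: top_compl ti; rewrite !inE eqxx.
(* An element on top of both candidate sets would exceed the minimum of [V] in every order, against
   domination. *)
- have yij : yi != yj.
    apply/eqP => e; subst yj.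
    have /dominatedP/(_ yi)[l rl] := domV.
    have [li|li] := eqVneq l i.
      subst l; have /candidatesP/(_ i ij) := tj.1.
      by rewrite ltnNge rl // least_in.
    have /candidatesP/(_ l li) := ti.1.
    by rewrite ltnNge rl // least_in.
  apply/eqP/cards2P; exists yi, yj; split => //; apply/setP => y; rewrite in_set2.
  apply/idP/orP => [/compl_top[k /set2P[]-> t]|[]/eqP->].
  + by left; apply/eqP; exact: (top_uniq i).
  + by right; apply/eqP; exact: (top_uniq j).
  + by apply: top_compl ti; rewrite !inE eqxx.
  + by apply: top_compl tj; rewrite !inE eqxx orbT.
Qed.

End Completions.

Section Parity.
Variable i0 : I.

(** By its size, a door carries each colour other than [i0] exactly once. *)
Definition door (V : {set X}) :=
  [&& dominated V, #|V|.+1 == #|I| & c @: V == [set~ i0]].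

(** If removing [x] leaves exactly the colours other than [i0], a unique other element [z] repeats
    the colour of [x]; then [x] and [z] are the only elements with this property. *)
Lemma even_doors (U : {set X}) : #|U| = #|I| -> c @: U != setT ->
  ~~ odd #|[set x in U | c @: (U :\ x) == [set~ i0]]|.
Proof.
move=> cardU cU; set D := [set x in U | _].
have [->|/set0Pn[x]] := eqVneq D set0; first by rewrite cards0.
rewrite inE => /andP[xU /eqP cx].
have UE : U = x |: (U :\ x) by rewrite setD1K.
have cx0 : c x != i0.
  apply: contra cU => /eqP cxi; rewrite UE imsetU1 cx cxi; apply/eqP/setP => i.
  by rewrite !inE orbN.
have inj : {in U :\ x &, injective c}.
  by apply/imset_injP; rewrite cx cardsC1 -cardU (cardsD1 x U) xU.
have /imsetP[z zUx cxz] : c x \in c @: (U :\ x) by rewrite cx !inE.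
have zx : z != x by move: zUx; rewrite !inE => /andP[].
have zU : z \in U by move: zUx; rewrite !inE => /andP[].
suff -> : D = [set x; z] by rewrite cards2 eq_sym zx.
apply/setP => w; rewrite in_set2 inE; apply/idP/orP => [/andP[wU /eqP cw]|].
  have [->|wx] := eqVneq w x; [by left|right].
  have /imsetP[y + cwy] : c w \in c @: (U :\ w).
    by rewrite cw -cx imset_f // !inE wx.
  rewrite !inE => /andP[yw yU].
  have [yx|yx] := eqVneq y x.
    by apply/eqP/inj; rewrite ?inE ?wx ?zx //= cwy yx.
  by move: yw; rewrite (inj y w) ?eqxx // !inE ?yx ?wx.
case=> /eqP->; first by rewrite xU cx eqxx.
rewrite zU -cx /= eqEsubset; apply/andP; split; apply/subsetP => i.
  case/imsetP => y; rewrite !inE => /andP[yz yU] ->.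
  have [->|yx] := eqVneq y x; first by rewrite cxz imset_f // !inE zx.
  by rewrite imset_f // !inE yx.
case/imsetP => y; rewrite !inE => /andP[yx yU] ->.
have [->|yz] := eqVneq y z; first by rewrite -cxz imset_f // !inE eq_sym zx.
by rewrite imset_f // !inE yz.
Qed.

(** Double counting of the pairs of a dominated set of full size and an element whose removal leaves
    a door; removal preserves domination. *)
Lemma sum_completions :
  \sum_(V | door V) #|completions V| =
  \sum_(U | dominated U && (#|U| == #|I|))
     #|[set x in U | c @: (U :\ x) == [set~ i0]]|.
Proof.
under eq_bigr => V _ do rewrite -sum1_card.
under [RHS]eq_bigr => V _ do rewrite -sum1_card.
rewrite (exchange_big_dep predT) //= [RHS](exchange_big_dep predT) //=.
apply: eq_bigr => y _.
rewrite [RHS](reindex_onto (fun V => y |: V) (fun U => U :\ y)) /=; last first.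
  by move=> U; rewrite !inE => /andP[_ /andP[yU _]]; rewrite setD1K.
apply: eq_bigl => V; rewrite !inE /door eqxx /=.
have [yV|yV] := boolP (y \in V).
  rewrite andbF; apply/esym/negbTE/negP => /andP[_ /eqP e].
  by move: yV; rewrite -e !inE eqxx.
rewrite setU1K // eqxx andbT cardsU1 yV /= add1n.
have [domU|] := boolP (dominated (y |: V)); last by rewrite andbF.
by rewrite (dominated_sub (subsetUr _ _) domU) /= andbT.
Qed.

(** The total number of completions of doors is odd, but [even_doors] would make it even if no
    dominated set of full size had all colours. *)
Lemma colorful_exists (V0 : {set X}) : door V0 -> odd #|completions V0| ->
  (forall V, door V -> V != V0 -> ~~ odd #|completions V|) ->
  exists U, [/\ dominated U, #|U| = #|I| & c @: U = setT].
Proof.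
move=> dV0 oddV0 evenV.
have [/existsP[U /and3P[dU /eqP cU /eqP cT]]|] := boolP
  [exists U, [&& dominated U, #|U| == #|I| & c @: U == setT]].
  by exists U.
rewrite negb_exists => /forallP noU.
have : odd (\sum_(V | door V) #|completions V|).
  rewrite (bigD1 V0) //= oddD oddV0 /=.
  apply: (big_ind (fun s => ~~ odd s)) => // [a b|V /andP[]]; last exact: evenV.
  by rewrite oddD => /negbTE-> /negbTE->.
rewrite sum_completions; set S := (\sum_(_ | _) _).
suff /negbTE-> : ~~ odd S by []; rewrite /S.
apply: (big_ind (fun s => ~~ odd s)) => // [a b|U /andP[dU /eqP cU]].
  by rewrite oddD => /negbTE-> /negbTE->.
by apply: even_doors => //; have := noU U; rewrite dU cU eqxx.
Qed.

End Parity.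
End Scarf.

(** * Scarf's lemma on the integer points of a dilated simplex *)

Section Grid.
Variables (n m : nat) (c : {ffun 'I_n.+1 -> 'I_m.+1} -> 'I_n.+1).
Local Notation I := 'I_n.+1.

Definition grid := {t : {ffun I -> 'I_m.+1} | \sum_i (t i : nat) == m}.
Definition grid_point (t : {ffun I -> 'I_m.+1}) (tm : \sum_i (t i : nat) == m) :
  grid := exist _ t tm.
Local Notation X := (grid + I)%type.

(** Order [i] compares the [i]-th coordinates of grid points and breaks ties by enumeration. The
    slack element [inr i] comes first in order [i]; the other slack elements come after all grid
    points. *)
Definition grid_rank (i : I) (x : X) : nat :=
  match x with
  | inl t => (val t i).+1 * #|{: grid}| + enum_rank t
  | inr j => if j == i then 0 else m.+2 * #|{: grid}| + j
  end.

Definition grid_colour (x : X) : I :=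
  match x with inl t => c (val t) | inr j => j end.

Lemma grid_rank_bounds i (t : grid) :
  0 < grid_rank i (inl t) < m.+2 * #|{: grid}|.
Proof.
have /= rt := ltn_ord (enum_rank t); have /= ti := ltn_ord (val t i).
rewrite /grid_rank; move: rt ti; move: #|_| (enum_rank t : nat) => K e.
by move: (val t i : nat) => a; nia.
Qed.

Lemma grid_rank_le i (t u : grid) :
  grid_rank i (inl t) <= grid_rank i (inl u) -> val t i <= val u i.
Proof.
have /= rt := ltn_ord (enum_rank t); have /= ru := ltn_ord (enum_rank u).
rewrite /grid_rank; move: rt ru.
move: #|_| (enum_rank t : nat) (enum_rank u : nat) => K e f.
by move: (val t i : nat) (val u i : nat) => a b; nia.
Qed.

Lemma card_grid_gt0 : 0 < #|{: grid}|.
Proof.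
have sumE : \sum_i (([ffun i : I => if i == ord0 then ord_max else ord0]
    : {ffun I -> 'I_m.+1}) i : nat) == m.
  rewrite (bigD1 ord0) //= ffunE /= big1 ?addn0 // => l /negbTE l0.
  by rewrite ffunE l0.
by apply/card_gt0P; exists (grid_point sumE).
Qed.

Lemma grid_rank_inj i : injective (grid_rank i).
Proof.
move=> [t|j] [u|k].
- move=> e; have tu : val t i = val u i :> nat.
    by apply/eqP; rewrite eqn_leq !grid_rank_le // e.
  move: e; rewrite /grid_rank tu => /addnI e.
  by congr inl; apply: enum_rank_inj; apply: val_inj.
- have /andP[p q] := grid_rank_bounds i t.
  move=> e; move: p q; rewrite e /=; case: eqP => // _ _.
  by rewrite ltnNge leq_addr.
- have /andP[p q] := grid_rank_bounds i u.
  move=> e; move: p q; rewrite -e /=; case: eqP => // _ _.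
  by rewrite ltnNge leq_addr.
have K0 := card_grid_gt0.
rewrite /=; have [->|ji] := eqVneq j i; have [->|ki] := eqVneq k i => //.
- by move: K0; move: #|_| => K; nia.
- by move: K0; move: #|_| => K; nia.
- by move=> /addnI e; congr inr; apply: val_inj.
Qed.

Local Notation dominated := (dominated grid_rank).
Local Notation least := (least grid_rank).

(** If a grid point is at most every element of [U] in order [i], then [U] cannot contain [inr i],
    which comes before all grid points in that order. *)
Lemma slack_not_dominated (U : {set X}) :
  dominated U -> exists i, inr i \notin U.
Proof.
move=> /dominatedP domU; have /card_gt0P[t _] := card_grid_gt0.
have [i ri] := domU (inl t); exists i; apply/negP => /ri.
by rewrite /= eqxx; have /andP[/= + _] := grid_rank_bounds i t; lia.
Qed.

Lemma dominated_le (U : {set X}) (t : grid) : dominated U ->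
  exists2 i, inr i \notin U & forall u : grid, inl u \in U -> val t i <= val u i.
Proof.
move=> /dominatedP/(_ (inl t))[i ri]; exists i => [|u /ri/grid_rank_le //].
apply/negP => /ri; rewrite /= eqxx.
by have /andP[/= + _] := grid_rank_bounds i t; lia.
Qed.

Definition slack_door : {set X} := [set inr i | i in [set~ ord0]].

Lemma mem_slack_door (x : X) :
  (x \in slack_door) = if x is inr i then i != ord0 else false.
Proof.
apply/imsetP/idP => [[i + ->]|]; first by rewrite !inE.
by case: x => // i i0; exists i; rewrite // !inE.
Qed.

(** Only the largest grid point in order [ord0] completes this door: [inr ord0] would bring all
    slack elements together, and with another grid point the largest one would exceed all minima. *)
Lemma slack_door_completion :
  exists t, completions grid_rank slack_door = [set inl t].
Proof.
have /card_gt0P[t0 t0T] := card_grid_gt0.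
have [t tmax] : exists t : grid, forall u : grid,
    grid_rank ord0 (inl u) <= grid_rank ord0 (inl t).
  exists [arg max_(t > t0) grid_rank ord0 (inl t)].
  by case: arg_maxnP => // t _ tmax u; exact: tmax.
exists t; apply/setP => y; rewrite in_set1.
rewrite inE mem_slack_door.
apply/andP/eqP => [[yV dU]|->].
  case: y yV dU => [u _ dU|j /negbNE/eqP-> dU]; last first.
    have [i] := slack_not_dominated dU.
    rewrite in_setU1 mem_slack_door.
    by have [->|i0] := eqVneq i ord0; rewrite ?eqxx ?orbT.
  have /dominatedP/(_ (inl t))[i ri] := dU.
  have [i0|i0] := eqVneq i ord0.
    subst i; apply: (@grid_rank_inj ord0); apply/eqP.
    by rewrite eqn_leq ri ?setU11 //= tmax.
  have : inr i \in inl u |: slack_door by rewrite in_setU1 mem_slack_door i0.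
  move=> /ri; rewrite /= eqxx.
  by have /andP[/= + _] := grid_rank_bounds i t; lia.
split=> //; apply/dominatedP => -[u|j].
  exists ord0 => x /setU1P[->|]; first exact: tmax.
  rewrite mem_slack_door; case: x => // i /negbTE i0.
  rewrite {2}/grid_rank i0.
  have /andP[_ /ltnW lt] := grid_rank_bounds ord0 u.
  exact: leq_trans lt (leq_addr _ _).
by exists j => x _; rewrite /= eqxx.
Qed.

Lemma slack_doorP : door grid_rank grid_colour ord0 slack_door.
Proof.
have domV : dominated slack_door.
  have [t /setP/(_ (inl t))] := slack_door_completion.
  rewrite set11 inE => /andP[_].
  by apply: dominated_sub; apply: subsetUr.
rewrite /door domV card_imset ?cardsC1 ?card_ord; last by move=> i j [].
rewrite eqxx /=; apply/eqP/setP => i; apply/imsetP/idP => [[x]|].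
  by rewrite mem_slack_door; case: x => // j j0 ->; rewrite !inE.
by rewrite !inE => i0; exists (inr i); rewrite // mem_slack_door.
Qed.

(** Any other door contains a grid point. Then [inr k] is a candidate for every [k], as it lies
    above all grid points in the other orders, and the door has exactly two completions. *)
Lemma grid_door_completions (V : {set X}) :
  door grid_rank grid_colour ord0 V -> V != slack_door ->
  ~~ odd #|completions grid_rank V|.
Proof.
move=> /and3P[domV /eqP cardV /eqP cV] VS.
have [t tV] : exists t, inl t \in V.
  apply/existsP; apply: contraNT VS; rewrite negb_exists => /forallP noT.
  apply/eqP/setP => -[t|i]; rewrite mem_slack_door; first exact/negbTE/noT.
  have : (i \in grid_colour @: V) = (i != ord0) by rewrite cV !inE.
  move=> <-; apply/idP/imsetP => [iV|[[t|j] jV]]; first by exists (inr i).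
    by have := noT t; rewrite jV.
  by move=> ->.
have [i [j [ij mij]]] := shared_min grid_rank_inj tV domV cardV.
rewrite (card_completions grid_rank_inj tV domV cardV ij mij).
have ne k : candidates grid_rank V (inl t) k != set0.
  apply/set0Pn; exists (inr k); apply/candidatesP => l lk.
  apply: leq_ltn_trans (least_le _ tV _ tV) _.
  rewrite {2}/grid_rank eq_sym (negbTE lk).
  by have /andP[_ lt] := grid_rank_bounds l t; apply: leq_trans lt (leq_addr _ _).
by rewrite !ne.
Qed.

(* Grid points stand for the points t / m of the standard simplex: some small
   set of them carries all the colours that are not forced to be irrelevant by
   an almost vanishing barycentric coordinate. *)
Lemma grid_colourful : exists x : {ffun I -> 'I_m.+1},
  \sum_i (x i : nat) = m /\
  forall j, x j <= n \/ exists t : {ffun I -> 'I_m.+1},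
    [/\ \sum_i (t i : nat) = m, c t = j &
        forall l, x l <= t l + n.+1 /\ t l <= x l + n.+1].
Proof.
have [|U [domU cardU cU]] :=
  @colorful_exists _ _ grid_rank grid_colour _ _ slack_doorP _ grid_door_completions.
  by have [t ->] := slack_door_completion; rewrite cards1.
pose C := [set i | inr i \notin U].
have [x0 x0U] : exists x0, inl x0 \in U.
  have [i iU] := slack_not_dominated domU.
  have : i \in grid_colour @: U by rewrite cU inE.
  by case/imsetP => -[t tU _|j jU ij]; [exists t|rewrite ij jU in iU].
pose a i : nat := val [arg min_(t < x0 | inl t \in U) val t i] i.
have a_le i (t : grid) : inl t \in U -> a i <= val t i.
  by rewrite /a; case: arg_minnP => // u _ H /H.
have a_in i : exists2 t : grid, inl t \in U & a i = val t i.
  by rewrite /a; case: arg_minnP => // u uU _; exists u.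
have [i1 i1C] : exists i, i \in C.
  by have [i iU] := slack_not_dominated domU; exists i; rewrite inE.
(* Otherwise some grid point would exceed [a i] in every coordinate of [C], which [dominated_le]
   forbids; the units left over are put on [i1]. *)
have sum_a : m < \sum_(i in C) (a i).+1.
  rewrite ltnNge; apply/negP => le_am.
  pose y i := (if i \in C then (a i).+1 else 0) +
              (if i == i1 then m - \sum_(i in C) (a i).+1 else 0).
  have sum_y : \sum_i y i = m.
    by rewrite big_split /= -big_mkcond -big_mkcond /= big_pred1_eq subnKC.
  have y_lt i : y i < m.+1 by rewrite ltnS -sum_y (bigD1 i) //= leq_addr.
  pose yf : {ffun I -> 'I_m.+1} := [ffun i => Ordinal (y_lt i)].
  have sum_yf : \sum_i (yf i : nat) == m.
    by rewrite -[X in _ == X]sum_y; apply/eqP/eq_bigr => i _; rewrite ffunE.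
  have [i iU yi] := dominated_le (grid_point sum_yf) domU.
  have [t tU ai] := a_in i; have := yi t tU.
  by rewrite /= ffunE /= /y inE iU -ai; lia.
(* The excess of [t] over [a] on [C] and the coordinates of [t] off [C] sum to [m] minus the sum of
   [a] over [C], which is less than [#|C|]. *)
have sumC (t : grid) : inl t \in U -> forall j,
    (j \in C -> val t j <= a j + n.+1) /\ (j \notin C -> val t j <= n).
  move=> tU j; have /eqP tm := valP t.
  have leC : #|C| <= n.+1 by rewrite -[X in _ <= X]card_ord max_card.
  have sumC1 (P : pred I) : \sum_(i in P) (a i).+1 = \sum_(i in P) a i + #|P|.
    by under eq_bigr => i _ do rewrite -addn1; rewrite big_split /= sum1_card.
  rewrite sumC1 in sum_a.
  split=> jC.
    have : \sum_(i in C) val t i <= m.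
      by rewrite -[X in _ <= X]tm [X in _ <= X](bigID (mem C)) /= leq_addr.
    rewrite (bigD1 j jC) /= => le_m; rewrite (bigD1 j jC) /= in sum_a.
    have le_at : \sum_(i in C | i != j) a i <= \sum_(i in C | i != j) val t i.
      by apply: leq_sum => i _; exact: a_le.
    rewrite -(leq_add2r (\sum_(i in C | i != j) a i)).
    have le_tm := leq_trans _ le_m; apply: leq_trans (le_tm _ _) _.
      by rewrite leq_add2l.
    by apply: leq_trans (ltnW sum_a) _; rewrite addnAC leq_add2r leq_add2l.
  have le_m : \sum_(i in C) val t i + val t j <= m.
    rewrite -[X in _ <= X]tm [X in _ <= X](bigID (mem C)) /= leq_add2l.
    by rewrite (bigD1 j) //= leq_addr.
  have le_at : \sum_(i in C) a i <= \sum_(i in C) val t i.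
    by apply: leq_sum => i _; exact: a_le.
  rewrite -ltnS -(ltn_add2l (\sum_(i in C) a i)).
  apply: leq_ltn_trans (leq_trans _ le_m) (leq_trans sum_a _).
    by rewrite leq_add2r.
  by rewrite leq_add2l.
exists (val x0); split=> [|j]; first exact/eqP/(valP x0).
have [jC|jC] := boolP (j \in C); last by left; apply: (sumC _ x0U j).2.
right; have : j \in grid_colour @: U by rewrite cU inE.
case/imsetP => -[t tU jt|k kU jk]; last by move: jC; rewrite inE jk kU.
exists (val t); split=> // [|l]; first exact/eqP/(valP t).
have close (p q b : nat) : b <= p -> p <= b + n.+1 -> b <= q -> q <= b + n.+1 ->
  p <= q + n.+1 /\ q <= p + n.+1 by lia.
have [lC|lC] := boolP (l \in C).
  by apply: (close _ _ (a l)); rewrite ?a_le // (sumC _ _ l).1.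
by apply: (close _ _ 0); rewrite // ltnW // ltnS (sumC _ _ l).2.
Qed.

End Grid.

From HB Require Import structures.
From mathcomp Require Import all_boot all_order all_algebra finmap.
From mathcomp Require Import all_classical all_reals all_analysis.
From mathcomp Require Import ring lra zify.

Import Order.TTheory GRing.Theory Num.Theory.
Import numFieldNormedType.Exports.

Local Open Scope classical_set_scope.
Local Open Scope ring_scope.

(** * Variational inequalities *)

Lemma mx_continuous (R : realType) (T : topologicalType) m n
    (f : T -> 'M[R]_(m, n)) :
  (forall i j, continuous (fun x => f x i j)) -> continuous f.
Proof.
move=> cf x A [P nP PA];
apply: (@filterS _ (nbhs x) _ (f @^-1` [set M | forall i j, P i j (M i j)])).
  by move=> y /= Py; apply: PA => i j; exact: Py.
apply: filter_forall => i; apply: filter_forall => j.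
by apply: cf; exact: nP.
Qed.

Lemma mx_norm_le (R : realType) m n (M : 'M[R]_(m, n)) (e : R) :
  0 <= e -> (forall i j, `|M i j| <= e) -> `|M| <= e.
Proof.
move=> e0 Me; rewrite [leLHS]/Num.norm /= mx_normrE.
by apply/bigmax_leP; split=> // -[i j] _; exact: Me.
Qed.

Lemma mx_entry_le_norm (R : realType) m n (M : 'M[R]_(m, n)) i j :
  `|M i j| <= `|M|.
Proof.
rewrite [leRHS]/Num.norm /= mx_normrE.
exact: (le_bigmax _ (fun ij : 'I_m * 'I_n => `|M ij.1 ij.2|) (i, j)).
Qed.

Lemma sum_continuous (R : realType) (T : topologicalType) (I : Type)
    (s : seq I) (f : I -> T -> R) :
  (forall i, continuous (f i)) -> continuous (fun x => \sum_(i <- s) f i x).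
Proof.
move=> cf; elim: s => [|i s IH] x.
  by under eq_fun do rewrite big_nil; exact: cvg_cst.
under eq_fun do rewrite big_cons.
by apply: cvgD; [exact: cf|exact: IH].
Qed.

(** * Complementarity on the standard simplex *)

Section Simplex.
Variable R : realType.

Definition simplex n : set 'rV[R]_n :=
  [set l | (forall i, 0 <= l ord0 i) /\ \sum_i l ord0 i = 1].

Lemma simplex_le1 n (l : 'rV[R]_n) i : simplex l -> l ord0 i <= 1.
Proof.
move=> [l0 <-]; rewrite (bigD1 i) //= lerDl.
by apply: sumr_ge0.
Qed.

Lemma simplex_compact n : compact (@simplex n).
Proof.
apply: bounded_closed_compact.
  exists 1; split=> // M M1 l sl; apply: le_trans (ltW M1).
  apply: mx_norm_le => // i j; rewrite ord1 ger0_norm ?simplex_le1 //; exact: sl.1.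
have -> : @simplex n =
    (\bigcap_(i in [set: 'I_n]) [set l : 'rV[R]_n | 0 <= l ord0 i]) `&`
    [set l : 'rV[R]_n | \sum_i l ord0 i = 1].
  apply/seteqP; split=> l [l0 l1]; split=> // i; [by move=> _; exact: l0|exact: l0].
apply: closedI.
  apply: closed_bigI => i _.
  apply: (@preimage_closed _ _ (fun l : 'rV[R]_n => l ord0 i) [set x | 0 <= x]).
    by move=> l _; exact: coord_continuous.
  exact: closed_ge.
apply: (@preimage_closed _ _ (fun l : 'rV[R]_n => \sum_i l ord0 i) [set x | x = 1]).
  by move=> l _; apply: sum_continuous => i; exact: coord_continuous.
exact: closed_eq.
Qed.

(** Each grid point is coloured by an index minimizing [g] there. The mesh is so fine that a
    displacement by [n.+1] units stays below [e]. *)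
Lemma simplex_approx n (g : 'rV[R]_n.+1 -> 'I_n.+1 -> R) (e : R) : 0 < e ->
  exists2 l, simplex l & forall j, l ord0 j < e \/
    exists l', `|l' - l| < e /\ forall k, g l' j <= g l' k.
Proof.
move=> e0; pose m := (Num.truncn (n.+1%:R / e)).
have em : n.+1%:R / m.+1%:R < e.
  rewrite ltr_pdivrMr ?ltr0n // mulrC -ltr_pdivrMr //.
  exact: truncnS_gt.
pose pt (t : {ffun 'I_n.+1 -> 'I_m.+2}) : 'rV[R]_n.+1 := \row_i ((t i)%:R / m.+1%:R).
pose c t : 'I_n.+1 := [arg min_(j < ord0) g (pt t) j]%O.
have [x [sx xc]] := grid_colourful c.
exists (pt x).
  split=> [i|]; first by rewrite mxE divr_ge0.
  under eq_bigr do rewrite mxE.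
  by rewrite -mulr_suml -natr_sum sx divff.
move=> j; have [xj|[t [st ctj tx]]] := xc j.
  left; rewrite mxE; apply: le_lt_trans em.
  by rewrite ler_pM2r ?invr_gt0 ?ltr0n // ler_nat (leq_trans xj).
right; exists (pt t); split.
  apply: le_lt_trans em; apply: mx_norm_le => [|i l]; first exact: divr_ge0.
  rewrite !mxE -mulrBl normrM [ `|m.+1%:R^-1|]ger0_norm ?invr_ge0 //.
  rewrite ler_pM2r ?invr_gt0 ?ltr0n //.
  have [p q] := tx l.
  by rewrite ler_distl lerBlDr -!natrD !ler_nat p q.
move=> k; rewrite -ctj /c.
by case: arg_minP => // i _; apply.
Qed.

(** At a cluster point of approximate solutions, [g] is minimal at every index of positive weight.
    The weighted sum being zero, this minimum is zero. *)
Lemma simplex_complementarity n (g : 'rV[R]_n.+1 -> 'I_n.+1 -> R) :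
  (forall j, continuous (g^~ j)) ->
  (forall l, simplex l -> \sum_j l ord0 j * g l j = 0) ->
  exists2 l, simplex l & forall j, 0 <= g l j.
Proof.
move=> cg g0.
pose e (m : nat) : R := m.+1%:R^-1.
have e_gt0 m : 0 < e m by rewrite invr_gt0.
have /choice[x /all_and2[sx xP]] : forall m, exists l, simplex l /\ forall j,
    l ord0 j < e m \/ exists l', `|l' - l| < e m /\ forall k, g l' j <= g l' k.
  by move=> m; have [l sl lP] := simplex_approx g (e_gt0 m); exists l.
have [l [sl cl]] : @simplex n.+1 `&` cluster (x @ \oo) !=set0.
  by apply: simplex_compact; exists 0%N => // m _; exact: sx.
exists l => //.
(* If [g l k < g l j], this inequality and a positive lower bound on the [j]-th weight persist near
   [l], which both alternatives for [x m] contradict once the mesh is small. *)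
have lP j : 0 < l ord0 j -> forall k, g l j <= g l k.
  move=> lj k; rewrite leNgt; apply/negP => gkj.
  have near_gt : \forall y \near l, l ord0 j / 2 < (y : 'rV[R]_n.+1) ord0 j.
    by apply: (cvgr_gt _ (@coord_continuous R 1 n.+1 ord0 j l)); lra.
  have near_lt : \forall y \near l, 0 < g y j - g y k.
    by apply: (cvgr_gt _ (cvgB (cg j l) (cg k l))); rewrite subr_gt0.
  have [d /= d0 dP] := (nbhs_ballP _ _).1 (filterI near_gt near_lt).
  have d2 : 0 < Num.min (d / 2) (l ord0 j / 2) by rewrite lt_min !divr_gt0.
  have near_e : (x @ \oo) (x @` [set m | e m < Num.min (d / 2) (l ord0 j / 2)]).
    have : \forall m \near \oo, e m < Num.min (d / 2) (l ord0 j / 2).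
      by apply: (cvgr_lt 0) => //; exact: cvg_harmonic.
    by apply: filterS => m em; exists m.
  have [_ [[m em <-] lm]] :=
    cl _ _ near_e (nbhsx_ballx l _ (divr_gt0 d0 (ltr0Sn R 1))).
  move: em => /=; rewrite lt_min => /andP[emd eml].
  have lmd : ball l d (x m) by apply: le_ball lm; lra.
  have [xl|[l' [l'x /(_ k)]]] := xP m j.
    by have [/= + _] := dP _ lmd; lra.
  have : ball l d l'.
    move: lm; rewrite -!ball_normE /= => lm.
    rewrite (le_lt_trans (ler_distD (x m) _ _)) // [ltRHS]splitr ltrD //.
    by rewrite distrC; apply: lt_trans emd.
  by move=> /dP[_] /=; rewrite subr_gt0 ltNge => /negP.
have [j lj] : exists j, 0 < l ord0 j.
  apply: contrapT => /forallNP l0; have := sl.2; rewrite big1 => [/eqP|i _].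
    by rewrite eq_sym oner_eq0.
  by apply/eqP; rewrite eq_le (sl.1 i) andbT leNgt; exact/negP/l0.
have <- : g l j = 0.
  rewrite -(g0 l sl) -[LHS]mul1r -sl.2 mulr_suml; apply: eq_bigr => i _.
  have := sl.1 i; rewrite le_eqVlt => /predU1P[<-|li]; first by rewrite !mul0r.
  by congr (_ * _); apply/eqP; rewrite eq_le !lP.
exact: lP.
Qed.

End Simplex.

Definition dotv (R : realType) n (u v : 'cV[R]_n) : R := (u^T *m v) ord0 ord0.

Section Dot.
Variables (R : realType) (n : nat).
Implicit Types u v w : 'cV[R]_n.

Lemma dotvE u v : dotv u v = \sum_k u k ord0 * v k ord0.
Proof. by rewrite /dotv mxE; under eq_bigr do rewrite mxE. Qed.

Lemma dotvDr u v w : dotv u (v + w) = dotv u v + dotv u w.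
Proof. by rewrite /dotv mulmxDr mxE. Qed.

Lemma dotvZr c u v : dotv u (c *: v) = c * dotv u v.
Proof. by rewrite /dotv -scalemxAr mxE. Qed.

Lemma dotvZl c u v : dotv (c *: u) v = c * dotv u v.
Proof. by rewrite /dotv linearZ -scalemxAl mxE. Qed.

Lemma dotvNl u v : dotv (- u) v = - dotv u v.
Proof. by rewrite -scaleN1r dotvZl mulN1r. Qed.

Lemma dotv_sumr (I : Type) (s : seq I) u (v : I -> 'cV[R]_n) :
  dotv u (\sum_(i <- s) v i) = \sum_(i <- s) dotv u (v i).
Proof. by rewrite /dotv mulmx_sumr summxE. Qed.

Lemma dotv_continuous (T : topologicalType) (f h : T -> 'cV[R]_n) :
  continuous f -> continuous h -> continuous (fun x => dotv (f x) (h x)).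
Proof.
move=> cf ch; under eq_fun do rewrite dotvE.
apply: sum_continuous => i x; apply: cvgM.
  exact: (cvg_comp _ _ (cf x) (@coord_continuous R n 1 i ord0 (f x))).
exact: (cvg_comp _ _ (ch x) (@coord_continuous R n 1 i ord0 (h x))).
Qed.

End Dot.

(** * The Hartman-Stampacchia theorem *)

Section Convex.
Variables (R : realType) (n : nat).
Implicit Type A : set 'cV[R]_n.

Lemma convex_setP A x y (t : R) : convex_set A -> 0 <= t -> t <= 1 ->
  A x -> A y -> A (t *: x + (1 - t) *: y).
Proof.
move=> cA t0 t1 /mem_set Ax /mem_set Ay.
by have /set_mem := cA x y (Itv01 t0 t1) Ax Ay.
Qed.

Lemma convex_set_sum A k (l : 'I_k -> R) (y : 'I_k -> 'cV[R]_n) :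
  convex_set A -> (forall j, A (y j)) -> (forall j, 0 <= l j) ->
  \sum_j l j = 1 -> A (\sum_j l j *: y j).
Proof.
move=> cA; elim: k l y => [|k IH] l y Ay l0.
  by rewrite big_ord0 => /eqP; rewrite eq_sym oner_eq0.
rewrite !big_ord_recl /= => l1.
set s := \sum_(i < k) l (lift ord0 i) in l1.
have s0 : 0 <= s by apply: sumr_ge0.
have [s00|sn0] := eqVneq s 0.
  rewrite big1 => [|i _]; last first.
    have /psumr_eq0P/(_ i isT) -> : \sum_(i < k) l (lift ord0 i) = 0 by [].
      by rewrite scale0r.
    by move=> *; exact: l0.
  by rewrite addr0; move: l1; rewrite s00 addr0 => ->; rewrite scale1r.
have -> : \sum_(i < k) l (lift ord0 i) *: y (lift ord0 i) =
    (1 - l ord0) *: \sum_(i < k) (l (lift ord0 i) / s) *: y (lift ord0 i).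
  rewrite scaler_sumr; apply: eq_bigr => i _; rewrite scalerA; congr (_ *: _).
  have -> : 1 - l ord0 = s by lra.
  by rewrite mulrCA divff // mulr1.
apply: convex_setP => //; first by lra.
by apply: IH => // [i|]; [exact: divr_ge0|rewrite -mulr_suml divff].
Qed.

(** By compactness it suffices to test finitely many points [y j] of [A]. At their convex
    combination [x l], the numbers [dotv (G (x l)) (y j - x l)] have weighted sum zero, so
    [simplex_complementarity] applies. *)
Lemma vi_exists A (G : 'cV[R]_n -> 'cV[R]_n) :
  A !=set0 -> compact A -> convex_set A -> continuous G ->
  exists2 x, A x & forall y, A y -> 0 <= dotv (G x) (y - x).
Proof.
move=> A0 compA convA contG.
pose K y := [set x | 0 <= dotv (G x) (y - x)].
have closedK y : closed (K y).
  apply: (@preimage_closed _ _ (fun x => dotv (G x) (y - x)) [set t | 0 <= t]).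
    move=> x _; apply: dotv_continuous => // z.
    by apply: continuousB; [exact: cst_continuous|exact: cvg_id].
  exact: closed_ge.
have := compA; rewrite compact_In0 => /(_ _ A (fun y => A `&` K y)).
case=> [|D DA|x xK].
- by exists K.
- pose s := finmap.enum_fset D.
  have DE y : y \in D -> exists j : 'I_(size s), tnth (in_tuple s) j = y.
    by move=> yD; have /tnthP[j ->] : y \in in_tuple s by []; exists j.
  have AD j : A (tnth (in_tuple s) j).
    by apply/set_mem/DA; exact: (mem_tnth j (in_tuple s)).
  move: DE AD; move: (tnth (in_tuple s)); move: (size s) => [|k] y DE AD.
    by have [x Ax] := A0; exists x => z /= /DE[[]].
  pose x (l : 'rV[R]_k.+1) := \sum_j l ord0 j *: y j.
  have cx : continuous x.
    apply: mx_continuous => i j.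
    have -> : (fun l => x l i j) =
        fun l : 'rV[R]_k.+1 => \sum_q l ord0 q * y q i j.
      by apply/funext => l; rewrite summxE; under eq_bigr do rewrite mxE.
    apply: sum_continuous => q l.
    by apply: continuousM; [exact: coord_continuous|exact: cst_continuous].
  have [j|l [l0 l1]|l [l0 l1] lK] := @simplex_complementarity R k
    (fun l j => dotv (G (x l)) (y j - x l)).
  + apply: dotv_continuous.
      by move=> l; exact: (cvg_comp _ _ (cx l) (contG (x l))).
    by move=> l; apply: continuousB; [exact: cst_continuous|exact: cx].
  + under eq_bigr do rewrite -dotvZr scalerBr.
    rewrite -dotv_sumr sumrB -scaler_suml l1 scale1r subrr.
    by rewrite -(scale0r 0) dotvZr mul0r.
  + exists (x l) => z /= /DE[j <-]; split; last exact: lK.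
    exact: convex_set_sum.
- exists x => [|y Ay]; last by have [] := xK y Ay.
  by have [y Ay] := A0; have [] := xK y Ay.
Qed.
End Convex.

(** * Calculus *)

Lemma lipschitz_on_bound (R : realType) (V W : normedModType R) (S : set V)
    (f : V -> W) :
  [lipschitz f x | x in S] ->
  exists2 L, 0 <= L & forall x y, S x -> S y -> `|f x - f y| <= L * `|x - y|.
Proof.
move=> /pinfty_ex_gt0[L L0 fL]; exists L => [|x y Sx Sy]; first exact: ltW.
exact: (fL (x, y)).
Qed.

Section Calculus.
Variables (R : realType) (n : nat).
Implicit Types (f : 'cV[R]_n -> R) (a b v : 'cV[R]_n).

Lemma derive_pderiv f a v : differentiable f a ->
  'D_v f a = \sum_k pderiv k f a * v k ord0.
Proof.
move=> df; rewrite deriveE // {1}(matrix_sum_delta v) linear_sum.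
apply: eq_bigr => k _; rewrite big_ord1 linearZ /= /pderiv deriveE //.
by rewrite mulrC.
Qed.

Lemma derive_along_segment f a v (t : R) : differentiable f (a + t *: v) ->
  is_derive t (1 : R) (fun s : R => f (a + s *: v)) ('D_v f (a + t *: v)).
Proof.
move=> df.
have qE : (fun h : R => h^-1 *:
      (((fun s : R => f (a + s *: v)) \o shift t) (h *: (1 : R)) -
       f (a + t *: v))) =
    (fun h : R => h^-1 *:
      ((f \o shift (a + t *: v)) (h *: v) - f (a + t *: v))).
  apply/funext => h /=; congr (_ *: (f _ - _)).
  have -> : h *: (1 : R) = h by exact: mulr1.
  by rewrite scalerDl addrCA.
split; first by rewrite /derivable qE; exact: diff_derivable.
by rewrite /derive qE.
Qed.

(** Mean value theorem on the segment, then the Lipschitz bounds on the partial derivatives, whose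
    constants are summed. *)
Lemma taylor1 f : (forall a, differentiable f a) ->
  (forall k, lipschitz (pderiv k f)) ->
  exists2 L, 0 <= L & forall a b,
    `|f b - f a - \sum_k pderiv k f a * (b - a) k ord0| <= L * `|b - a| ^+ 2.
Proof.
move=> df lipf.
have /choice[L /all_and2[L0 fL]] : forall k, exists L, 0 <= L /\
    forall x y, `|pderiv k f x - pderiv k f y| <= L * `|x - y|.
  move=> k; have [L L0 fL] := lipschitz_on_bound (lipf k).
  by exists L; split=> // x y; exact: fL.
exists (\sum_k L k) => [|a b]; first exact: sumr_ge0.
pose v := b - a.
have cphi : {within `[0, 1], continuous (fun s : R => f (a + s *: v))}.
  apply: derivable_within_continuous => t _.
  by have [] := derive_along_segment (df (a + t *: v)).
have [c c01] := MVT ltr01 (fun t _ => derive_along_segment (df (a + t *: v))) cphi.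
rewrite scale1r scale0r addr0 subr0 mulr1 subrKC => ->.
rewrite derive_pderiv // -sumrB mulr_suml.
apply: le_trans (ler_norm_sum _ _ _) _; apply: ler_sum => k _.
rewrite -/v -mulrBl normrM expr2 mulrA ler_pM ?mx_entry_le_norm //.
apply: le_trans (fL _ _ _) _; apply: ler_wpM2l => //.
move: c01; rewrite in_itv /= => /andP[c0 c1].
by rewrite addrC addKr normrZ (ger0_norm (ltW c0)) ler_piMl // ltW.
Qed.

(** The difference quotients along the segment are at most [f (a + w) - f a], hence so is their
    limit. *)
Lemma convex_derive_le f a w : differentiable f a ->
  (forall t, 0 <= t -> t <= 1 -> f (a + t *: w) <= f a + t * (f (a + w) - f a)) ->
  'D_w f a <= f (a + w) - f a.
Proof.
move=> df cf; rewrite leNgt; apply/negP => lt.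
have [e /= e0 eP] :=
  (nbhs_ballP _ _).1 (cvgr_gt _ (diff_derivable (v := w) df) _ lt).
pose t := Num.min (e / 2) 1.
have t0 : 0 < t by rewrite lt_min ltr01 divr_gt0.
have /eP/(_ (lt0r_neq0 t0)) : ball 0 e t.
  rewrite -ball_normE /= sub0r normrN gtr0_norm // gt_min.
  by rewrite ltr_pdivrMr // mulr_natr mulr2n ltrDl e0.
rewrite /= [t *: w + a]addrC ltNge => /negP; apply.
rewrite -[_ *: _]/(_ * _) -ler_pdivlMl ?invr_gt0 // invrK lerBlDl.
by apply: cf; [exact: ltW|rewrite ge_min lexx orbT].
Qed.

Lemma is_derive_dotv (e a v : 'cV[R]_n) : is_derive a v (dotv e) (dotv e v).
Proof.
have qE : h^-1 *: ((dotv e \o shift a) (h *: v) - dotv e a)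
    @[h --> (0 : R)^'] --> dotv e v.
  apply: cvg_near_cst.
  near=> h; rewrite /= dotvDr dotvZr addrK /GRing.scale /= mulKf //.
  by near: h; exact: nbhs_dnbhs_neq.
split; first exact: (cvgP _ qE).
exact/cvg_lim.
Unshelve. all: by end_near.
Qed.

Lemma differentiable_dotv (e a : 'cV[R]_n) : differentiable (dotv e) a.
Proof.
have lin : linear (dotv e : 'cV[R]_n -> R^o).
  by move=> c u v; rewrite dotvDr dotvZr.
pose H := GRing.isLinear.Build _ _ _ _ _ lin.
pose L : {linear 'cV[R]_n -> R^o} := HB.pack (dotv e : 'cV[R]_n -> R^o) H.
apply: (@linear_differentiable _ _ _ L) => b /=.
apply: (@dotv_continuous _ _ _ (cst e) id) => x; last exact: cvg_id.
exact: cst_continuous.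
Qed.

Lemma pderiv_dotv (e a : 'cV[R]_n) k : pderiv k (dotv e) a = e k ord0.
Proof.
rewrite /pderiv; have [_ ->] := is_derive_dotv e a (delta_mx k ord0).
rewrite dotvE (bigD1 k) //= big1 ?addr0 => [|l lk]; rewrite mxE ?eqxx ?mulr1 //.
by rewrite (negbTE lk) mulr0.
Qed.

Lemma enorm0 : enorm (0 : 'cV[R]_n) = 0.
Proof. by rewrite /enorm big1 ?sqrtr0 // => i _; rewrite mxE expr0n. Qed.

Lemma enormN a : enorm (- a) = enorm a.
Proof. by congr Num.sqrt; apply: eq_bigr => i _; rewrite mxE sqrrN. Qed.

Lemma enorm_ge0 a : 0 <= enorm a.
Proof. exact: sqrtr_ge0. Qed.

Lemma norm_le_enorm a : `|a| <= enorm a.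
Proof.
apply: mx_norm_le => [|i j]; first exact: enorm_ge0.
rewrite ord1 -sqrtr_sqr ler_sqrt; last by apply: sumr_ge0 => k _; exact: sqr_ge0.
by rewrite (bigD1 i) //= lerDl; apply: sumr_ge0 => k _; exact: sqr_ge0.
Qed.

Lemma enorm_le_norm a : enorm a <= n.+1%:R * `|a|.
Proof.
rewrite -[leRHS]ger0_norm ?mulr_ge0 // -sqrtr_sqr ler_sqrt ?sqr_ge0 //.
apply: (@le_trans _ _ (\sum_(j < n) `|a| ^+ 2)).
  apply: ler_sum => i _; rewrite -real_normK ?num_real //.
  by rewrite lerXn2r ?nnegrE ?mx_entry_le_norm.
rewrite sumr_const card_ord exprMn -[leLHS]mulr_natl ler_wpM2r ?sqr_ge0 //.
by rewrite -natrX ler_nat; lia.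
Qed.

Lemma enormZ_le (c : R) a : 0 <= c -> c <= 1 -> enorm (c *: a) <= enorm a.
Proof.
move=> c0 c1; rewrite ler_sqrt; last by apply: sumr_ge0 => k _; exact: sqr_ge0.
apply: ler_sum => i _; rewrite mxE exprMn ler_piMl ?sqr_ge0 //.
exact: exprn_ile1.
Qed.

End Calculus.

(** * Games *)

Section Game.
Variables (R : realType) (N : nat) (d : 'I_N -> nat).
Variables (A : forall i, set 'cV[R]_(d i)).
Local Notation sig1 := (@tagnat.sig1 N d).
Implicit Types (a b e : profile R d) (i : 'I_N) (J : 'I_N -> profile R d -> R).

Lemma pseudogradientE J a s :
  pseudogradient J a s ord0 = pderiv s (J (sig1 s)) a.
Proof. by rewrite /pseudogradient mxE mxE tagnat.sig2K. Qed.

Lemma game_hessianE J a s t :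
  game_hessian J a s t = pderiv t (pderiv s (J (sig1 s))) a.
Proof. by rewrite /game_hessian !mxE !tagnat.sig2K. Qed.

Lemma submxcol_deviate a i (x : 'cV[R]_(d i)) : submxcol (deviate a x) i = x.
Proof. by rewrite /deviate mxcolK dfwithin. Qed.

Lemma submxcol_deviate_neq a i (x : 'cV[R]_(d i)) j : i != j ->
  submxcol (deviate a x) j = submxcol a j.
Proof. by move=> ij; rewrite /deviate mxcolK dfwithout. Qed.

Lemma deviate_neq a i (x : 'cV[R]_(d i)) s : sig1 s != i ->
  deviate a x s ord0 = a s ord0.
Proof.
rewrite eq_sym => si.
have /matrixP/(_ (tagnat.sig2 s) ord0) := submxcol_deviate_neq a x si.
by rewrite !mxE !tagnat.sig2K.
Qed.

Lemma deviate_same a i : deviate a (submxcol a i) = a.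
Proof.
apply/mxcolP => j; have [<-|ij] := eqVneq i j; first by rewrite submxcol_deviate.
exact: submxcol_deviate_neq.
Qed.

Lemma deviate_affine a i (x y : 'cV[R]_(d i)) (t : R) :
  deviate a (t *: x + (1 - t) *: y) = t *: deviate a x + (1 - t) *: deviate a y.
Proof.
apply/mxcolP => j; rewrite submxcolD.
have submxcolZ (c : R) b : submxcol (c *: b) j = c *: submxcol b j.
  by apply/matrixP => k l; rewrite !mxE.
rewrite !submxcolZ; have [<-|ij] := eqVneq i j; first by rewrite !submxcol_deviate.
by rewrite !submxcol_deviate_neq // -scalerDl subrKC scale1r.
Qed.

Lemma deviate_profiles a i (x : 'cV[R]_(d i)) :
  profiles A a -> A x -> profiles A (deviate a x).
Proof.
move=> Aa Ax j; have [ij|ij] := eqVneq i j; last by rewrite submxcol_deviate_neq.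
by subst j; rewrite submxcol_deviate.
Qed.

Definition own_part e i : profile R d := \col_s (e s ord0 *+ (sig1 s == i)).

(* The game J + e : adding to each cost a term that is linear in the player's
   own action shifts the pseudogradient by the constant vector e. *)
Definition tilt J e i a := J i a + dotv (own_part e i) a.

Lemma pderiv_tilt J e i s : (forall a, differentiable (J i) a) ->
  pderiv s (tilt J e i) = fun a => pderiv s (J i) a + own_part e i s ord0.
Proof.
move=> dJ; apply/funext => a; rewrite /pderiv deriveD; last first.
- by have [] := is_derive_dotv (own_part e i) a (delta_mx s ord0).
- exact: diff_derivable.
by congr (_ + _); exact: pderiv_dotv.
Qed.

Lemma smooth_tilt J e : smooth_game J -> smooth_game (tilt J e).
Proof.
move=> sJ i; have [dJ ddJ cJ lJ] := sJ i.
have p2 j k : pderiv k (pderiv j (tilt J e i)) = pderiv k (pderiv j (J i)).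
  apply/funext => a; rewrite pderiv_tilt // {1}/pderiv.
  rewrite (_ : (fun _ => _) = pderiv j (J i) + cst (own_part e i j ord0)) //.
  by rewrite deriveD ?derive_cst ?addr0 //; exact: diff_derivable.
split=> [a|j a|j k|j k]; rewrite ?p2 //.
  by apply: differentiableD => //; exact: differentiable_dotv.
by rewrite pderiv_tilt //; apply: differentiableD.
Qed.

Lemma pseudogradient_tilt J e : smooth_game J ->
  forall a, pseudogradient (tilt J e) a = pseudogradient J a + e.
Proof.
move=> sJ a; apply/matrixP => s j.
rewrite (_ : j = ord0) ?[in RHS]mxE ?pseudogradientE; last exact: ord1.
have [dJ _ _ _] := sJ (sig1 s).
by rewrite pderiv_tilt // [own_part _ _ _ _]mxE eqxx tagnat.sig2K.
Qed.

Lemma convex_tilt J e : playerwise_convex A J -> playerwise_convex A (tilt J e).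
Proof.
move=> cJ i; have [cJi ? ?] := cJ i; split=> // a t x y xT yT.
have := cJi a t x y xT yT; rewrite /tilt.
rewrite -[conv t x y]/(t%:num *: (x : 'cV[R]_(d i)) +
                       (1 - t%:num) *: (y : 'cV[R]_(d i))).
rewrite deviate_affine dotvDr !dotvZr => le_J.
set X := (X in _ <= X); have -> : X =
    (t%:num * J i (deviate a x) + (1 - t%:num) * J i (deviate a y)) +
    (t%:num * dotv (own_part e i) (deviate a x) +
     (1 - t%:num) * dotv (own_part e i) (deviate a y)).
  by rewrite /X convRE /unstable.onem; ring.
by rewrite lerD2r.
Qed.

(** A unilateral deviation moves only the coordinates of player [i], where the pseudogradient is the
    gradient of [J i]. The derivative of [J i] along it is thus nonnegative, which suffices by
    convexity. *)
Lemma vi_NE J a : smooth_game J -> playerwise_convex A J -> profiles A a ->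
  (forall b, profiles A b -> 0 <= dotv (pseudogradient J a) (b - a)) ->
  is_NE A J a.
Proof.
move=> sJ cJ Aa vi i; split=> [|x Ax]; first exact: Aa.
have [dJ _ _ _] := sJ i; have [cJi _ _] := cJ i.
set w := deviate a x - a.
have := vi _ (deviate_profiles Aa Ax); rewrite -/w.
have -> : dotv (pseudogradient J a) w = 'D_w (J i) a.
  rewrite derive_pderiv // dotvE; apply: eq_bigr => s _; rewrite pseudogradientE.
  have [<- //|si] := eqVneq (sig1 s) i.
  by rewrite [w s _]mxE deviate_neq // [(- a) s _]mxE subrr !mulr0.
move=> Dw; rewrite -subr_ge0 (le_trans Dw) //.
have -> : deviate a x = a + w by rewrite /w subrKC.
apply: convex_derive_le => // t t0 t1.
have -> : a + t *: w = deviate a (t *: x + (1 - t) *: submxcol a i).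
  by rewrite deviate_affine deviate_same /w scalerBr scalerBl scale1r addrCA addrA.
have := cJi a (Itv01 t0 t1) x (submxcol a i) (in_setT _) (in_setT _).
rewrite convRE /= /unstable.onem deviate_same.
have -> : a + w = deviate a x by rewrite /w subrKC.
by move=> /le_trans; apply; rewrite le_eqVlt; apply/orP; left; apply/eqP; ring.
Qed.

End Game.

(** * The equilibrium set and the global form of stability *)

Section Equilibria.
Variables (R : realType) (N : nat) (d : 'I_N -> nat).
Variables (A : forall i, set 'cV[R]_(d i)) (J : 'I_N -> profile R d -> R).
Hypotheses (sJ : smooth_game J) (cJ : playerwise_convex A J).
Implicit Types (a b e : profile R d).

Lemma profiles_compact : compact (profiles A).
Proof.
pose stack (f : prod_topology (fun i => 'cV[R]_(d i))) : profile R d :=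
  \mxcol_i f i.
have -> : profiles A = stack @` [set f | forall i, A (f i)].
  apply/seteqP; split=> [a Aa|_ [f Af <-] i]; last by rewrite mxcolK.
  by exists (fun i => submxcol a i) => //; rewrite /stack submxcolK.
apply: (@continuous_compact (prod_topology (fun i => 'cV[R]_(d i))) _ stack);
  last first.
  by apply: tychonoff => i; have [_ + _] := cJ i.
apply: continuous_subspaceT; apply: mx_continuous => s j f.
have -> : (fun g => stack g s j) =
    (fun M : 'cV[R]_(d (tagnat.sig1 s)) => M (tagnat.sig2 s) j) \o
    (fun g : prod_topology (fun i => 'cV[R]_(d i)) => g (tagnat.sig1 s)).
  by apply/funext => g /=; rewrite mxE.
apply: continuous_comp; last exact: coord_continuous.
exact: (@proj_continuous _ (fun i => 'cV[R]_(d i)) (tagnat.sig1 s)).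
Qed.

Lemma profiles_convex : convex_set (profiles A).
Proof.
move=> a b t /set_mem Aa /set_mem Ab; apply/mem_set => i.
have [_ _ /(_ (submxcol a i) (submxcol b i) t)] := cJ i.
move=> /(_ (mem_set (Aa i)) (mem_set (Ab i)))/set_mem.
congr (A _); apply/matrixP => k l.
by rewrite !mxE.
Qed.

Lemma continuous_deviate i (x : 'cV[R]_(d i)) : continuous (fun a => deviate a x).
Proof.
apply: mx_continuous => s l; rewrite (_ : l = ord0); last exact: ord1.
have [si|si] := eqVneq (tagnat.sig1 s) i; last first.
  have -> : (fun a => deviate a x s ord0) = (fun a => a s ord0).
    by apply/funext => a; exact: deviate_neq.
  exact: coord_continuous.
have -> : (fun a => deviate a x s ord0) = cst (deviate 0 x s ord0).
  apply/funext => a; subst i.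
  have /matrixP/(_ (tagnat.sig2 s) ord0) := submxcol_deviate a x.
  have /matrixP/(_ (tagnat.sig2 s) ord0) := submxcol_deviate 0 x.
  by rewrite ![submxcol _ _ _ _]mxE !tagnat.sig2K => -> ->.
exact: cst_continuous.
Qed.

Lemma NESet_closed : closed (NESet A J).
Proof.
have -> : NESet A J = profiles A `&`
    \bigcap_(ix in [set ix : {i & 'cV[R]_(d i)} | A (tagged ix)])
    [set a | 0 <= J (tag ix) (deviate a (tagged ix)) - J (tag ix) a].
  apply/seteqP; split=> [a NEa|a [Aa NEa] i]; first split.
  - by move=> i; have [] := NEa i.
  - by move=> [i x] /= Ax; rewrite subr_ge0; have [_] := NEa i; apply.
  - by split=> [|x Ax]; [exact: Aa|rewrite -subr_ge0; exact: (NEa (Tagged _ x))].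
apply: closedI.
  apply: compact_closed; last exact: profiles_compact.
  exact: norm_hausdorff.
apply: closed_bigI => -[i x] /= _.
apply: (@preimage_closed _ _ (fun a => J i (deviate a x) - J i a)
  [set t | 0 <= t]); last exact: closed_ge.
have cJi : continuous (J i).
  by move=> a; apply: differentiable_continuous; have [] := sJ i.
move=> a _; apply: continuousB; last exact: cJi.
exact: (continuous_comp (@continuous_deviate i x a) (cJi _)).
Qed.

(* If there were other equilibria, then the open ball around a that reaches to
   the nearest one would be isolating, while that equilibrium lies in its
   closure; this contradicts stability for the unperturbed game. *)
Lemma stable_NE_unique a : stable_NE A J a -> NESet A J = [set a].
Proof.
move=> [NEa [Om [openOm Oma isoOm]] stab].
apply/seteqP; split=> [b NEb|_ ->//]; apply: contrapT => /= ba.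
(* These are exactly the equilibria other than [a]; being compact, they include a nearest one. *)
pose T := NESet A J `&` ~` Om.
have compT : compact T.
  apply: (subclosed_compact _ profiles_compact) => [|x [NEx _] i]; last first.
    by have [] := NEx i.
  by apply: closedI; [exact: NESet_closed|exact: open_closedC].
have T0 : T !=set0.
  exists b; split=> // Omb; apply: ba.
  by have : (NESet A J `&` Om) b by []; rewrite isoOm.
have [|b0 /set_mem[NEb0 Omb0] b0min] :=
    @compact_EVT_min _ R (fun x : profile R d => `|x - a|) T T0 compT.
  apply: continuous_subspaceT => x.
  apply: (continuous_comp (f := fun x : profile R d => x - a)
                          (g := @Num.norm R _)).
    by apply: continuousB; [exact: cvg_id|exact: cst_continuous].
  exact: norm_continuous.
have b0a : b0 != a by apply/eqP => e; apply: Omb0; rewrite e.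
pose r := `|b0 - a|.
have r0 : 0 < r by rewrite normr_gt0 subr_eq0.
have [|c [eps [c0 eps0 stabB]]] := stab (ball a r).
  split; [exact: ball_open|exact: ballxx|].
  apply/seteqP; split=> [x [NEx]|_ ->]; last by split=> //; exact: ballxx.
  rewrite -ball_normE /= distrC => xr.
  have [Omx|Omx] := pselect (Om x).
    by have : (NESet A J `&` Om) x by []; rewrite isoOm.
  by move: xr; rewrite ltNge b0min // inE.
have [] := stabB J.
  split=> //; apply: le_lt_trans (_ : 0%:E < _)%E; last by rewrite lte_fin.
  by apply: ge_ereal_sup => _ [x _ <-]; rewrite subrr enorm0.
move=> _ /(_ b0); rewrite subrr enorm0 mulr0 => stabb0.
move: b0a; rewrite -subr_eq0 -normr_le0 => /negP; apply.
apply: le_trans (norm_le_enorm _) (stabb0 _); split=> //.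
rewrite -[closure _]/(closed_ball a r) closed_ballE //.
by rewrite /closed_ball_ /= distrC.
Qed.

(** As [a] is the only equilibrium, the whole space is isolating, so the stability estimate holds
    wherever [u] lies. The inequality makes [u] an equilibrium of [tilt J e]. *)
Lemma stable_NE_tilt a : stable_NE A J a ->
  exists c eps : R, [/\ 0 < c, 0 < eps & forall e u,
    enorm e < eps -> profiles A u ->
    (forall b, profiles A b -> 0 <= dotv (pseudogradient J u + e) (b - u)) ->
    enorm (u - a) <= c * enorm e].
Proof.
move=> sa; have NE_a := stable_NE_unique sa; have [_ _ stab] := sa.
have [|c [eps [c0 eps0 stabT]]] := stab setT.
  by split=> //; [exact: openT|rewrite setIT].
exists c, eps; split=> // e u e_eps Au vi_u.
have [|_ /(_ u)] := stabT (tilt J e).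
  split; [exact: smooth_tilt|exact: convex_tilt|].
  apply: le_lt_trans (_ : (enorm e)%:E < _)%E; last by rewrite lte_fin.
  apply: ge_ereal_sup => _ [x _ <-]; rewrite pseudogradient_tilt //.
  by rewrite opprD addNKr enormN.
rewrite pseudogradient_tilt // opprD addNKr enormN; apply.
split; last by rewrite closureT.
apply: vi_NE; [exact: smooth_tilt|exact: convex_tilt|exact: Au|].
by move=> b; rewrite pseudogradient_tilt //; exact: vi_u.
Qed.

End Equilibria.

(** * The perturbed Newton update *)

Lemma mulmx_norm_le (R : realType) m n p (M : 'M[R]_(m, n)) (X : 'M[R]_(n, p)) :
  `|M *m X| <= n%:R * `|M| * `|X|.
Proof.
apply: mx_norm_le => [|i j]; first by rewrite !mulr_ge0.
rewrite mxE; apply: le_trans (ler_norm_sum _ _ _) _.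
apply: (@le_trans _ _ (\sum_(k < n) `|M| * `|X|)).
  by apply: ler_sum => k _; rewrite normrM ler_pM ?mx_entry_le_norm.
by rewrite sumr_const card_ord -[leLHS]mulr_natl mulrA.
Qed.

Lemma lipschitz_near_bound (R : realType) n (W E : normedModType R) (V : set W)
    (a : 'cV[R]_n) (G : 'cV[R]_n -> W -> E) : V 0 -> lipschitz_near V a G ->
  exists r L, [/\ 0 < r, 0 <= L &
    forall b v, enorm (b - a) < r -> V v -> `|v| < r ->
    `|G b v - G b 0| <= L * `|v|].
Proof.
move=> V0 [r r0 /lipschitz_on_bound[L L0 GL]].
exists r, L; split=> // b v br Vv vr.
have := GL (b, v) (b, 0) (And3 br Vv vr) (And3 br V0 _).
rewrite /= normr0 => /(_ r0).
by move=> /le_trans; apply; rewrite prod_normE /= subrr subr0 normr0 max_r.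
Qed.

Lemma continuous_enorm (R : realType) n : continuous (@enorm R n).
Proof.
move=> x.
apply: (continuous_comp (f := fun y : 'cV[R]_n => \sum_j y j ord0 ^+ 2)
                        (g := Num.sqrt)); last exact: sqrt_continuous.
apply: sum_continuous => j; under eq_fun do rewrite expr2; move=> y.
by apply: continuousM; exact: coord_continuous.
Qed.

Section Newton.
Variables (R : realType) (N : nat) (d : 'I_N -> nat).
Variables (A : forall i, set 'cV[R]_(d i)) (J : 'I_N -> profile R d -> R).
Variables (W : normedModType R) (V : set W).
Variables (Fv : profile R d -> W -> profile R d).
Variables (Hv : profile R d -> W -> 'M[R]_(\sum_i d i)%N).
Variable astar : profile R d.
Hypotheses (sJ : smooth_game J) (cJ : playerwise_convex A J).
Hypotheses (V0 : V 0) (Fv0 : forall a, Fv a 0 = pseudogradient J a).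
Hypotheses (Hv0 : forall a, Hv a 0 = game_hessian J a).
Hypotheses (Fv_lip : lipschitz_near V astar Fv) (Hv_lip : lipschitz_near V astar Hv).
Implicit Types (a b e u : profile R d) (v : W).
Local Notation F := (pseudogradient J).
Local Notation H := (game_hessian J).

Lemma continuous_pseudogradient : continuous F.
Proof.
apply: mx_continuous => s l; rewrite (_ : l = ord0); last exact: ord1.
have -> : (fun a => F a s ord0) = pderiv s (J (tagnat.sig1 s)).
  by apply/funext => a; rewrite pseudogradientE.
move=> a; apply: differentiable_continuous.
by have [_ + _ _] := sJ (tagnat.sig1 s); apply.
Qed.

Lemma pseudogradient_taylor : exists2 L, 0 <= L & forall a u,
  `|F a + H a *m (u - a) - F u| <= L * `|u - a| ^+ 2.
Proof.
have /choice[L /all_and2[L0 FL]] : forall s, exists L, 0 <= L /\ forall a u,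
    `|(F a + H a *m (u - a) - F u) s ord0| <= L * `|u - a| ^+ 2.
  move=> s; have [_ dJ _ lJ] := sJ (tagnat.sig1 s).
  have [L L0 FL] := taylor1 (dJ s) (lJ s); exists L; split=> // a u.
  apply: le_trans (FL a u); rewrite -normrN le_eqVlt; apply/orP; left; apply/eqP.
  congr `|_|; rewrite !mxE !tagnat.sig2K.
  have -> : \sum_j H a s j * (u - a) j ord0 =
      \sum_k pderiv k (pderiv s (J (tagnat.sig1 s))) a * (u - a) k ord0.
    by apply: eq_bigr => t _; rewrite game_hessianE.
  by ring.
exists (\sum_s L s) => [|a u]; first exact: sumr_ge0.
apply: mx_norm_le => [|s l]; first by rewrite mulr_ge0 ?sqr_ge0 ?sumr_ge0.
rewrite (_ : l = ord0); last exact: ord1.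
apply: le_trans (FL s a u) _; apply: ler_wpM2r; first exact: sqr_ge0.
by rewrite (bigD1 s) //= lerDl sumr_ge0.
Qed.

(** The shift [e] for which the linearized operator at [u] equals [F u + e]. *)
Definition newton_gap a v u : profile R d :=
  Fv a v + Hv a v *m (u - a) - F u.

(** The gap splits into the effect of the disturbance on [Fv], its effect on [Hv] applied to the
    step, and the Taylor remainder of [F]. *)
Lemma newton_gap_le : exists C r, [/\ 0 < C, 0 < r & forall a v u,
  enorm (a - astar) < r -> V v -> `|v| < r ->
  enorm (newton_gap a v u) <= C * (`|u - a| ^+ 2 + `|v| * (1 + `|u - a|))].
Proof.
have [r1 [L1 [r10 L10 FL]]] := lipschitz_near_bound V0 Fv_lip.
have [r2 [L2 [r20 L20 HL]]] := lipschitz_near_bound V0 Hv_lip.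
have [L L0 FH] := pseudogradient_taylor.
set n := (\sum_i d i)%N.
(* The factor [n.+1%:R] passes from the max norm to the Euclidean one; the summand 1 keeps the
   constant positive. *)
exists (n.+1%:R * (1 + L + L1 + n%:R * L2)), (Num.min r1 r2).
have C0 : 0 < 1 + L + L1 + n%:R * L2 :> R.
  have : 0 <= n%:R * L2 by exact: mulr_ge0.
  by lra.
split=> [||a v u]; [exact: mulr_gt0|by rewrite lt_min r10|].
rewrite !lt_min => /andP[ar1 ar2] Vv /andP[vr1 vr2].
apply: le_trans (enorm_le_norm _) _; rewrite -mulrA ler_wpM2l //.
have -> : newton_gap a v u = (Fv a v - Fv a 0) + (Hv a v - Hv a 0) *m (u - a) +
    (F a + H a *m (u - a) - F u).
  rewrite /newton_gap mulmxBl Hv0 Fv0.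
  by apply/matrixP => s l; rewrite !mxE; ring.
have w0 : 0 <= `|u - a| by []; have v0 : 0 <= `|v| by [].
have Hle : `|(Hv a v - Hv a 0) *m (u - a)| <= n%:R * L2 * (`|v| * `|u - a|).
  apply: le_trans (mulmx_norm_le _ _) _.
  by rewrite [leRHS]mulrA ler_wpM2r // -mulrA ler_wpM2l // HL.
apply: le_trans (ler_normD _ _) _; apply: le_trans (lerD (ler_normD _ _) (FH a u)) _.
apply: le_trans (lerD (lerD (FL a v ar1 Vv vr1) Hle) (lexx _)) _.
have nL : 0 <= n%:R * L2 by exact: mulr_ge0.
move: nL w0 v0; move: (n%:R * L2) `|u - a| `|v| => K w x K0 w0 x0.
have := mulr_ge0 x0 w0; have := mulr_ge0 L10 (mulr_ge0 x0 w0); have := sqr_ge0 w.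
have := mulr_ge0 K0 x0; have := mulr_ge0 L0 x0; have := mulr_ge0 L0 (mulr_ge0 x0 w0).
have := mulr_ge0 K0 (sqr_ge0 w); have := mulr_ge0 L10 (sqr_ge0 w).
have := mulr_ge0 K0 (mulr_ge0 x0 w0).
by lra.
Qed.

(** [t = 0] gives the variational inequality of the game, [t = 1] that of the update. *)
Definition newton_vi (t : R) a v u :=
  forall b, profiles A b -> 0 <= dotv (F u + t *: newton_gap a v u) (b - u).

Hypothesis astar_stable : stable_NE A J astar.

Lemma newton_contraction : exists dl dv Lv : R,
  [/\ 0 < dl, 0 < dv, 0 <= Lv, Lv * dv <= dl / 3 &
   forall a v, enorm (a - astar) < dl -> V v -> `|v| < dv ->
   forall (t : R) u, 0 <= t -> t <= 1 -> profiles A u -> newton_vi t a v u ->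
   (0 < t -> enorm (u - astar) < 2 * dl) ->
   enorm (u - astar) <= 3^-1 * enorm (a - astar) + Lv * `|v|].
Proof.
have [c [eps [c0 eps0 stab]]] := stable_NE_tilt sJ cJ astar_stable.
have [C [r [C0 r0 gapC]]] := newton_gap_le.
have cC0 := mulr_gt0 c0 C0.
(* Let [s], [p], [x] be the sizes of [u - astar], [a - astar], [v]. The choice of [dl] gives
   [s + p < 3 * dl <= 1], [C * (3 * dl) <= eps / 3] and [c * C * (3 * dl) <= 1 / 4]; that of [dv]
   gives [2 * C * x < eps / 3] and [Lv * dv <= dl / 3]. *)
pose dl := Num.min (Num.min r 3^-1) (Num.min (eps / (9 * C)) (12 * (c * C))^-1).
pose dv := Num.min (Num.min r (eps / (6 * C))) (dl / (8 * (c * C))).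
have dl0 : 0 < dl.
  by rewrite !lt_min r0 !invr_gt0 divr_gt0 ?mulr_gt0 ?ltr0n.
have dv0 : 0 < dv by rewrite !lt_min r0 !divr_gt0 ?mulr_gt0.
have : dl <= dl by []; rewrite {2}/dl !le_min => /andP[/andP[dlr dl3] /andP[]].
rewrite ler_pdivlMr ?mulr_gt0 // => dleps.
rewrite -[(12 * _)^-1]div1r ler_pdivlMr ?mulr_gt0 // => dlcC.
have : dv <= dv by []; rewrite {2}/dv !le_min => /andP[/andP[dvr]].
rewrite ler_pdivlMr ?mulr_gt0 // => dveps; rewrite ler_pdivlMr ?mulr_gt0 // => dvcC.
exists dl, dv, (8 / 3 * (c * C)); split=> //.
- by rewrite mulr_ge0 // ltW.
- by move: dvcC; move: (c * C) => K; lra.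
move=> a v adl Vv vdv t u t0 t1 Au vi_u udl.
have [t00|tn0] := eqVneq t 0.
  have := stab 0 u; rewrite enorm0 mulr0 => /(_ eps0 Au) le0.
  apply: le_trans (le0 _) _.
    by move=> b Ab; rewrite addr0; have := vi_u b Ab; rewrite t00 scale0r addr0.
  by rewrite addr_ge0 // !mulr_ge0 ?enorm_ge0 // ltW.
have {udl}sdl : enorm (u - astar) < 2 * dl.
  by apply: udl; rewrite lt_neqAle eq_sym tn0.
have gap_le : enorm (t *: newton_gap a v u) <=
    C * (`|u - a| ^+ 2 + `|v| * (1 + `|u - a|)).
  apply: le_trans (enormZ_le _ t0 t1) (gapC _ _ _ _ Vv _).
    exact: lt_le_trans dlr.
  exact: lt_le_trans dvr.
have w_le : `|u - a| <= enorm (u - astar) + enorm (a - astar).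
  rewrite (le_trans (ler_distD astar _ _)) // lerD ?norm_le_enorm //.
  by rewrite distrC norm_le_enorm.
have := stab (t *: newton_gap a v u) u.
have := enorm_ge0 (u - astar); have := enorm_ge0 (a - astar).
have : 0 <= `|v| by []; have : 0 <= `|u - a| by [].
move: adl vdv sdl gap_le w_le.
move: (enorm (_ - _)) (enorm (u - astar)) `|v| `|u - a| (enorm (t *: _)).
move=> p s x w E pdl xdv sdl gap_le w_le w0 x0 p0 s0.
(* Here [w <= s + p < 3 * dl <= 1] bounds both [w ^+ 2] and [1 + w]. *)
have E_le : E <= C * (3 * dl) * (s + p) + 2 * C * x.
  apply: le_trans gap_le _; rewrite mulrDr lerD //.
    rewrite -mulrA ler_wpM2l ?(ltW C0) // expr2 ler_pM //; lra.
  have -> : 2 * C * x = C * (x * 2) by ring.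
  by rewrite !ler_wpM2l ?(ltW C0) //; lra.
move=> /(_ _ Au vi_u) le_s.
have {}le_s : s <= c * E.
  apply: le_s; apply: le_lt_trans E_le _.
  have Cdl : C * (3 * dl) <= eps / 3 by lra.
  have : C * (3 * dl) * (s + p) <= eps / 3 * (s + p).
    by apply: ler_wpM2r => //; lra.
  have : eps / 3 * (s + p) <= eps / 3 * 1 by apply: ler_wpM2l; lra.
  have : C * x < C * dv by rewrite ltr_pM2l.
  by lra.
(* This yields [s <= (s + p) / 4 + 2 * c * C * x]; solving for [s] gives the rate 1/3 and the gain
   [8 / 3 * (c * C)]. *)
have := ler_wpM2l (ltW c0) E_le => cE_le.
have : c * C * dl * (s + p) <= 12^-1 * (s + p) by apply: ler_wpM2r; lra.
by lra.
Qed.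

(** Solves the inequality of [F] plus a cut-off multiple of the gap; [t] is the value of the cut-off
    at the solution. *)
Lemma newton_solution a v (dl : R) : 0 < dl -> exists u (t : R),
  [/\ 0 <= t, t <= 1, profiles A u, newton_vi t a v u &
      (0 < t -> enorm (u - astar) < 2 * dl) /\
      (enorm (u - astar) <= dl -> t = 1)].
Proof.
move=> dl0.
(* Equal to 1 up to distance [dl] from [astar], to 0 from [2 * dl] on, and affine in the distance in
   between. *)
pose cut : profile R d -> R :=
  cst 0 \max (cst 1 \min (fun u => 2 - enorm (u - astar) / dl)).
have ccut : continuous cut.
  move=> u; apply: continuous_max; first exact: cst_continuous.
  apply: continuous_min; first exact: cst_continuous.
  apply: continuousB; first exact: cst_continuous.
  apply: continuousM; last exact: cst_continuous.
  apply: (continuous_comp (f := fun u : profile R d => u - astar)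
                          (g := @enorm R _)).
    by apply: continuousB; [exact: cvg_id|exact: cst_continuous].
  exact: continuous_enorm.
have cgap : continuous (fun u : profile R d => Fv a v + Hv a v *m (u - a) - F u).
  move=> u; apply: (continuousB
    (f := fun u : profile R d => Fv a v + Hv a v *m (u - a)) (g := F));
    last exact: continuous_pseudogradient.
  apply: continuousD; first exact: cst_continuous.
  apply: (continuous_comp (f := fun u : profile R d => u - a)
                          (g := fun w => Hv a v *m w)).
    by apply: continuousB; [exact: cvg_id|exact: cst_continuous].
  apply: mx_continuous => s l.
  have -> : (fun w : profile R d => (Hv a v *m w) s l) =
      fun w => \sum_k Hv a v s k * w k l.
    by apply/funext => w; rewrite mxE.
  apply: sum_continuous => k w.
  by apply: continuousM; [exact: cst_continuous|exact: coord_continuous].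
have [NEa _ _] := astar_stable.
have [||||u Au vi_u] := @vi_exists R _ (profiles A)
  (fun u => F u + cut u *: newton_gap a v u).
- by exists astar => i; have [] := NEa i.
- exact: profiles_compact cJ.
- exact: profiles_convex cJ.
- move=> u; apply: continuousD; first exact: continuous_pseudogradient.
  by apply: continuousZ; [exact: ccut|exact: cgap].
exists u, (cut u); split=> //.
- by rewrite /cut /= le_max lexx.
- by rewrite /cut /= ge_max ler01 ge_min lexx.
split; rewrite /cut /=.
  by rewrite lt_max ltxx lt_min ltr01 /= subr_gt0 ltr_pdivrMr.
move=> sdl; have : enorm (u - astar) / dl <= 1 by rewrite ler_pdivrMr // mul1r.
by move=> le1; rewrite min_l ?max_r //; lra.
Qed.

Lemma JN_updateE a v u :
  JN_update (profiles A) Fv Hv a v u <-> profiles A u /\ newton_vi 1 a v u.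
Proof.
have gapE : F u + 1 *: newton_gap a v u = Fv a v + Hv a v *m (u - a).
  by rewrite scale1r /newton_gap addrC subrK.
split=> [[b [Au bA] /eqP]|[Au vi_u]].
  rewrite addr_eq0 => /eqP e; split=> // y Ay.
  by rewrite gapE e dotvNl oppr_ge0; exact: bA.
exists (- (F u + 1 *: newton_gap a v u)); last by rewrite gapE subrr.
split=> // y Ay; rewrite -[X in X <= _]/(dotv _ _) dotvNl oppr_le0.
exact: vi_u.
Qed.

End Newton.

Theorem theorem5 (R : realType) (N : nat) (d : 'I_N -> nat)
    (A : forall i : 'I_N, set 'cV[R]_(d i))
    (J : 'I_N -> profile R d -> R)
    (W : normedModType R) (V : set W)
    (Fv : profile R d -> W -> profile R d)
    (Hv : profile R d -> W -> 'M[R]_(\sum_i d i)%N)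
    (astar : profile R d)
    (J_smooth : smooth_game J)
    (J_convex : playerwise_convex A J)
    (astar_stable : stable_NE A J astar)
    (V0 : V 0)
    (Fv0 : forall a, Fv a 0 = pseudogradient J a)
    (Hv0 : forall a, Hv a 0 = game_hessian J a)
    (Fv_lipschitz : lipschitz_near V astar Fv)
    (Hv_lipschitz : lipschitz_near V astar Hv) :
  exists delta_a delta_v La Lv : R,
    [/\ 0 < delta_a, 0 < delta_v, La < 1 &
      forall a0, (profiles A `&` eball astar delta_a) a0 ->
      forall v : nat -> W, (forall k, V (v k)) ->
        (ereal_sup (range (fun k => `|v k|%:E)) < delta_v%:E)%E ->
      let generated :=
        JN_sequence (profiles A) Fv Hv (eball astar delta_a) a0 v in
      (exists a, generated a) /\
      (forall a, generated a -> forall k,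
         enorm (a k.+1 - astar) <= La * enorm (a k - astar) + Lv * `|v k|)].
Proof.
have [dl [dv [Lv [dl0 dv0 Lv0 Lvdv contr]]]] :=
  newton_contraction J_smooth J_convex V0 Fv0 Hv0 Fv_lipschitz Hv_lipschitz
    astar_stable.
exists dl, dv, 3^-1, Lv; split=> //; first by lra.
move=> a0 [_ a0dl] v Vv v_sup.
have v_dv k : `|v k| < dv.
  rewrite -lte_fin; apply: le_lt_trans v_sup.
  by apply: ereal_sup_ubound; exists k.
have next a w : eball astar dl a -> V w -> `|w| < dv ->
    exists u, JN_update (profiles A) Fv Hv a w u /\ eball astar dl u.
  move=> adl Vw wdv.
  have [u [t [t0 t1 Au vi_u [tdl t_1]]]] :=
    newton_solution Fv Hv J_smooth J_convex astar_stable a w dl0.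
  have s_le := contr a w adl Vw wdv t u t0 t1 Au vi_u tdl.
  have Lw : Lv * `|w| <= Lv * dv by rewrite ler_wpM2l // ltW.
  (* Both terms of the estimate are at most [dl / 3], so [u] lies where the cut-off is 1 and is a
     true update. *)
  have udl : enorm (u - astar) < dl.
    by move: adl; rewrite /eball /=; lra.
  exists u; split; last exact: udl.
  apply/(JN_updateE A J); split; first exact: Au.
  by rewrite -(t_1 (ltW udl)).
split; last first.
  move=> a [a_0 aP] k.
  have adl : eball astar dl (a k).
    by case: k => [|k]; [rewrite a_0|have [] := aP k].
  have [/(JN_updateE A J)[Au vi_u] udl] := aP k.
  apply: (contr _ _ adl (Vv k) (v_dv k) 1 _ ler01 (lexx _) Au vi_u) => _.
  by move: udl; rewrite /eball /=; lra.
(* The step index is part of the argument because the disturbance varies with it; outside the ball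
   the value is a dummy. *)
have /choice[g gP] : forall ka : nat * profile R d, exists u,
    eball astar dl ka.2 ->
    JN_update (profiles A) Fv Hv ka.2 (v ka.1) u /\ eball astar dl u.
  move=> [k a]; have [adl|nadl] := pselect (eball astar dl a); last by exists a.
  by have [u uP] := next a (v k) adl (Vv k) (v_dv k); exists u.
pose a := fix a k := if k is k'.+1 then g (k', a k') else a0.
have a_dl k : eball astar dl (a k).
  by elim: k => // k IH; have [] := gP (k, a k) IH.
by exists a; split=> // k; exact: gP (k, a k) (a_dl k).
Qed.
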